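(* Let the delay $r>0$, $\boldsymbol f(\cdot)\in C^1([-r,0];\mathbb R^d)$ and $M\in\mathbb R^{d\times d}$ be as in the context. The closed-loop system (CLS) of the context with the supply rate function $\mathsf s$ is dissipative, and the trivial solution $\boldsymbol x(t)\equiv\mathbf 0_n$ of the CLS with $\boldsymbol w(t)\equiv\mathbf 0_q$ is globally asymptotically stable, if there exist $K\in\mathbb R^{p\times n}$, $P\in\mathbb S^n$, $Q\in\mathbb R^{n\times dn}$, $R\in\mathbb S^{dn}$ and $S,U\in\mathbb S^n$ such that $$\begin{bmatrix}P&Q\\ *&R+\mathsf F\otimes S\end{bmatrix}\succ0,\qquad S\succ0,\qquad U\succ0,\qquad \boldsymbol\Phi+\mathsf{Sy}(\mathbf P^\top\boldsymbol\Pi)\prec0,$$ where $\mathsf F^{-1}=\int_{-r}^0\boldsymbol f(\tau)\boldsymbol f^\top(\tau)d\tau$, $\mathbf P=[\,P\ \ \mathsf O_n\ \ Q\ \ \mathsf O_{n,q}\ \ \mathsf O_{n,m}]$, $\boldsymbol\Pi=[\,\mathbf A+\mathbf B_1[(I_{2+d}\otimes K)\oplus\mathsf O_q]\ \ \ \mathsf O_{n,m}]$ and $$\boldsymbol\Phi=\mathsf{Sy}\left(\begin{bmatrix}Q\\ \mathsf O_{n,dn}\\ R\\ \mathsf O_{(q+m),dn}\end{bmatrix}\begin{bmatrix}\mathbf F&\mathsf O_{dn,m}\end{bmatrix}\right)+\mathsf{Sy}\left(\begin{bmatrix}\mathsf O_{(2n+dn),m}\\ -J_2^\top\\ \widetilde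 J\end{bmatrix}\begin{bmatrix}\boldsymbol\Sigma&\mathsf O_m\end{bmatrix}\right)+(S+rU)\oplus(-S)\oplus(-\mathsf F\otimes U)\oplus(-J_3)\oplus J_1$$ with $$\mathbf F=\begin{bmatrix}F(0)&-F(-r)&-M\otimes I_n&\mathsf O_{dn,q}\end{bmatrix},\qquad \boldsymbol\Sigma=\mathbf C+\mathbf B_2[(I_{2+d}\otimes K)\oplus\mathsf O_q].$$
   Context: Notation: $\mathsf{Sy}(X)=X+X^\top$; $X\oplus Y$ is block diagonal; $\otimes$ is the Kronecker product; $\mathbb S^n$ = real symmetric $n\times n$ matrices; $\mathsf O_{n,m}$ zero matrix, $\mathsf O_n=\mathsf O_{n,n}$; $*$ denotes blocks determined by symmetry. Functions: $\boldsymbol f\in C^1([-r,0];\mathbb R^d)$ satisfies $\boldsymbol f'(\tau)=M\boldsymbol f(\tau)$ and $\int_{-r}^0\boldsymbol f\boldsymbol f^\top d\tau\succ0$; $F(\tau)=\boldsymbol f(\tau)\otimes I_n\in\mathbb R^{dn\times n}$. Open-loop system, for $t\ge t_0$: $\dot{\boldsymbol x}(t)=A_1\boldsymbol x(t)+A_2\boldsymbol x(t-r)+\int_{-r}^0A_3F(\tau)\boldsymbol x(t+\tau)d\tau+B_1\boldsymbol u(t)+B_2\boldsymbol u(t-r)+\int_{-r}^0B_3(\boldsymbol f(\tau)\otimes I_p)\boldsymbol u(t+\tau)d\tau+D_1\boldsymbol w(t)$, $\boldsymbol z(t)=C_1\boldsymbol x(t)+C_2\boldsymbol x(t-r)+\int_{-r}^0C_3F(\tau)\boldsymbol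 x(t+\tau)d\tau+B_4\boldsymbol u(t)+B_5\boldsymbol u(t-r)+\int_{-r}^0B_6(\boldsymbol f(\tau)\otimes I_p)\boldsymbol u(t+\tau)d\tau+D_2\boldsymbol w(t)$, with $\boldsymbol x(t)\in\mathbb R^n$, $\boldsymbol u(t)\in\mathbb R^p$, $\boldsymbol z(t)\in\mathbb R^m$, $\boldsymbol w\in\mathcal L^2([t_0,\infty);\mathbb R^q)$ and constant matrices of compatible size ($A_3\in\mathbb R^{n\times dn}$, $B_3\in\mathbb R^{n\times dp}$, $C_3\in\mathbb R^{m\times dn}$, $B_6\in\mathbb R^{m\times dp}$). CLS (with $\boldsymbol u=K\boldsymbol x$): $\dot{\boldsymbol x}(t)=(\mathbf A+\mathbf B_1[(I_{2+d}\otimes K)\oplus\mathsf O_q])\boldsymbol\chi(t)$, $\boldsymbol z(t)=(\mathbf C+\mathbf B_2[(I_{2+d}\otimes K)\oplus\mathsf O_q])\boldsymbol\chi(t)$, $t\ge t_0$, $\boldsymbol x(t_0+\theta)=\boldsymbol\phi(\theta)$ for $\theta\in[-r,0]$, $\boldsymbol\phi\in C([-r,0];\mathbb R^n)$, where $\boldsymbol\chi(t)$ stacks $\boldsymbol x(t)$, $\boldsymbol x(t-r)$, $\int_{-r}^0F(\tau)\boldsymbol x(t+\tau)d\tau$, $\boldsymbol w(t)$, and $\mathbf A=[A_1\ A_2\ A_3\ D_1]$, $\mathbf B_1=[B_1\ B_2\ B_3\ \mathsf O_{n,q}]$, $\mathbf C=[C_1\ C_2\ C_3\ D_2]$, $\mathbf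 B_2=[B_4\ B_5\ B_6\ \mathsf O_{m,q}]$. Supply rate: $\mathsf s(\boldsymbol z,\boldsymbol w)=\begin{bmatrix}\boldsymbol z\\ \boldsymbol w\end{bmatrix}^\top\begin{bmatrix}\widetilde J^\top J_1^{-1}\widetilde J&J_2\\ *&J_3\end{bmatrix}\begin{bmatrix}\boldsymbol z\\ \boldsymbol w\end{bmatrix}$ with $J_1\in\mathbb S^m$, $J_1^{-1}\prec0$, $\widetilde J\in\mathbb R^{m\times m}$, $J_2\in\mathbb R^{m\times q}$, $J_3\in\mathbb S^q$ (so $\widetilde J^\top J_1^{-1}\widetilde J\preceq0$). Dissipative: there is a differentiable functional $\mathsf v:C([-r,0];\mathbb R^n)\to\mathbb R_{\ge0}$ such that $\frac{d}{dt}\mathsf v(\mathbf x_t(\cdot))-\mathsf s(\boldsymbol z(t),\boldsymbol w(t))\le0$ for all $t\ge t_0$ along the CLS, where $\mathbf x_t(\theta)=\boldsymbol x(t+\theta)$, $\theta\in[-r,0]$. *)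

(* Defs.v *)
From HB Require Import structures.
From mathcomp Require Import all_boot all_order all_algebra.
From mathcomp Require Import all_classical all_reals all_analysis.
From mathcomp Require Import mxtens.
Set Implicit Arguments.
Unset Strict Implicit.
Unset Printing Implicit Defensive.
Import Order.TTheory GRing.Theory Num.Theory.
Import numFieldNormedType.Exports.
Local Open Scope classical_set_scope.
Local Open Scope ring_scope.

Section Matrices.
Context {R : realType}.

Definition Sy k (X : 'M[R]_k) : 'M[R]_k := X + X^T.

Definition dsum a b a' b' (X : 'M[R]_(a, b)) (Y : 'M[R]_(a', b')) :
  'M[R]_(a + a', b + b') := block_mx X 0 0 Y.

Definition symmetric_mx k (X : 'M[R]_k) : Prop := X^T = X.

Definition posdef k (X : 'M[R]_k) : Prop :=
  symmetric_mx X /\ forall y : 'cV[R]_k, y != 0 -> 0 < (y^T *m X *m y) 0 0.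

Definition negdef k (X : 'M[R]_k) : Prop := posdef (- X).

(* fI k c is c (x) I_k; the cast only replaces the width 1 * k by k. *)
Definition fI d k (c : 'cV[R]_d) : 'M[R]_(d * k, k) :=
  castmx (erefl, mul1n k) (c *t (1%:M : 'M[R]_k)).

(* (I_{2+d} (x) K) (+) O_q.  The type ascription uses that (2 + d) * k is
   convertible to k + (k + d * k), the block sizes of the stacked vectors. *)
Definition gain p n d q (K : 'M[R]_(p, n)) :
    'M[R]_(p + (p + d * p) + q, n + (n + d * n) + q) :=
  dsum (((1%:M : 'M[R]_(2 + d)) *t K) : 'M[R]_(p + (p + d * p), n + (n + d * n)))
       (0 : 'M[R]_q).

Definition row4 k a b c e (X1 : 'M[R]_(k, a)) (X2 : 'M[R]_(k, b))
    (X3 : 'M[R]_(k, c)) (X4 : 'M[R]_(k, e)) : 'M[R]_(k, a + (b + c) + e) :=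
  row_mx (row_mx X1 (row_mx X2 X3)) X4.

End Matrices.

Section Calculus.
Context {R : realType}.

Definition mint a b (r : R) (G : R -> 'M[R]_(a, b)) : 'M[R]_(a, b) :=
  \matrix_(i, j) Rintegral lebesgue_measure `[- r, 0] (fun tau => G tau i j).

(* Derivative of f at t relative to D: two-sided at interior points of the
   interval D, one-sided at its end points. *)
Definition has_deriv_in (V : normedModType R) (D : set R) (f : R -> V) (t : R)
    (l : V) : Prop :=
  h^-1 *: (f (t + h) - f t) @[h --> within [set h | D (t + h)] (0 : R)^'] --> l.

Definition C1_on d (r : R) (f : R -> 'cV[R]_d) : Prop :=
  exists2 f' : R -> 'cV[R]_d,
    forall tau : R, tau \in `[- r, 0] -> has_deriv_in `[- r, 0] f tau (f' tau) &
    {within `[- r, 0], continuous f'}.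

Definition abs_continuous (V : normedModType R) (a b : R) (f : R -> V) : Prop :=
  forall e : R, 0 < e -> exists2 del : R, 0 < del &
    forall (k : nat) (l u : 'I_k -> R),
      (forall i, a <= l i /\ l i <= u i /\ u i <= b) ->
      (forall i j, i != j -> u i <= l j \/ u j <= l i) ->
      \sum_i (u i - l i) < del -> \sum_i `|f (u i) - f (l i)| < e.

Definition L2_from q (t0 : R) (w : R -> 'cV[R]_q) : Prop :=
  forall i, (fun t => w t i 0) \_ `[t0, +oo[ \in Lfun lebesgue_measure 2%:E.

(* The space C([-r,0]; R^n): elements are total functions, of which only the
   values on [-r,0] matter. *)
Definition hist_space n (r : R) : set (R -> 'cV[R]_n) :=
  [set phi | {within `[- r, 0], continuous phi}].

Definition hist_norm n (r : R) (phi : R -> 'cV[R]_n) : R :=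
  sup [set `|phi theta| | theta in `[- r, 0]].

Definition on_hist_space n (r : R) (v : (R -> 'cV[R]_n) -> R) : Prop :=
  forall phi psi, hist_space r phi -> hist_space r psi ->
    (forall theta : R, theta \in `[- r, 0] -> phi theta = psi theta) ->
    v phi = v psi.

(* Frechet differentiability on the Banach space C([-r,0]; R^n). *)
Definition hist_differentiable n (r : R) (v : (R -> 'cV[R]_n) -> R) : Prop :=
  forall phi, hist_space r phi -> exists L : (R -> 'cV[R]_n) -> R,
    [/\ forall (a : R) g h, hist_space r g -> hist_space r h ->
          L (a *: g + h) = a * L g + L h,
        exists c : R, forall h, hist_space r h -> `|L h| <= c * hist_norm r h &
        forall e : R, 0 < e -> exists2 del : R, 0 < del &
          forall h, hist_space r h -> hist_norm r h <= del ->
            `|v (phi + h) - v phi - L h| <= e * hist_norm r h].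

Definition segment n (x : R -> 'cV[R]_n) (t : R) : R -> 'cV[R]_n :=
  fun theta => x (t + theta).

End Calculus.

Section ClosedLoop.
Context {R : realType}.
Variables (n m d q : nat) (r : R) (f : R -> 'cV[R]_d).
(* x' = Acl chi and z = Ccl chi, started at time t0. *)
Variables (Acl : 'M[R]_(n, n + (n + d * n) + q))
          (Ccl : 'M[R]_(m, n + (n + d * n) + q)) (t0 : R).

Definition chi (x : R -> 'cV[R]_n) (w : R -> 'cV[R]_q) (t : R) :
    'cV[R]_(n + (n + d * n) + q) :=
  col_mx (col_mx (x t)
         (col_mx (x (t - r)) (mint r (fun tau => fI n (f tau) *m x (t + tau)))))
         (w t).

Definition state_eq_at x w t : Prop :=
  has_deriv_in `[t0, +oo[ x t (Acl *m chi x w t).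

Definition output x w t : 'cV[R]_m := Ccl *m chi x w t.

(* Caratheodory solutions: as w is only square integrable, the differential
   equation can be required for almost every t >= t0 only. *)
Definition cls_solution (phi : R -> 'cV[R]_n) (w : R -> 'cV[R]_q)
    (x : R -> 'cV[R]_n) : Prop :=
  [/\ forall theta : R, theta \in `[- r, 0] -> x (t0 + theta) = phi theta,
      forall b, abs_continuous t0 b x &
      {ae lebesgue_measure, forall t : R, t0 <= t -> state_eq_at x w t}].

(* The dissipation inequality is required at every t >= t0 where the state
   equation holds: at almost every t >= t0 for any solution, at all t >= t0 for
   a classical one. *)
Definition dissipative (s : 'cV[R]_m -> 'cV[R]_q -> R) : Prop :=
  exists v : (R -> 'cV[R]_n) -> R,
    [/\ on_hist_space r v,
        forall phi, hist_space r phi -> 0 <= v phi,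
        hist_differentiable r v &
        forall phi w x, hist_space r phi -> L2_from t0 w ->
          cls_solution phi w x ->
          forall t, t0 <= t -> state_eq_at x w t ->
          exists2 dv : R,
            has_deriv_in `[t0, +oo[ (fun t' => v (segment x t') : R^o) t dv &
            dv - s (output x w t) (w t) <= 0].

Definition globally_asymptotically_stable : Prop :=
  (forall e : R, 0 < e -> exists2 del : R, 0 < del &
     forall phi x, hist_space r phi -> hist_norm r phi < del ->
       cls_solution phi (fun=> 0) x -> forall t, t0 <= t -> `|x t| < e) /\
  (forall phi x, hist_space r phi -> cls_solution phi (fun=> 0) x ->
     x t @[t --> +oo] --> (0 : 'cV[R]_n)).

End ClosedLoop.

Definition supply_rate {R : realType} m q (J1 Jt : 'M[R]_m) (J2 : 'M[R]_(m, q))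
    (J3 : 'M[R]_q) (z : 'cV[R]_m) (w : 'cV[R]_q) : R :=
  ((col_mx z w)^T *m block_mx (Jt^T *m invmx J1 *m Jt) J2 J2^T J3
     *m col_mx z w) 0 0.

(* Main.v *)
Require Import Defs.
From HB Require Import structures.
From mathcomp Require Import all_boot all_order all_algebra.
From mathcomp Require Import all_classical all_reals all_analysis.
From mathcomp Require Import mxtens.
From mathcomp Require Import ring lra.
Set Implicit Arguments.
Unset Strict Implicit.
Unset Printing Implicit Defensive.
Import Order.TTheory GRing.Theory Num.Theory.
Import numFieldNormedType.Exports.
Local Open Scope classical_set_scope.
Local Open Scope ring_scope.

(** Both claims follow from the quadratic Krasovskii functional
      v(phi) = Y^T [P Q; Q^T R] Y + int_[-r,0] phi^T (S + (tau + r) U) phi,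
    where Y = (phi(0), xi) and xi = int F phi collects the moments of phi against
    the entries of f ([krasovskii], [fmoment]).

    Since f' = M f, the moments of the segment x_t have the derivative
    F(0) x(t) - F(-r) x(t-r) - (M (x) I) xi ([fmoment_deriv]), and v(x_t) is
    differentiable wherever x is ([krasovskii_deriv]). Both rest on a Leibniz rule
    for int a(tau) g(t + tau) dtau with g merely continuous
    ([delay_integral_deriv]). The derivative of v contains minus the integral of
    x^T U x over the delay interval. By Bessel's inequality for the Gram matrix
    G of f ([fmoment_bessel]) it is at most - xi^T (G^-1 (x) U) xi. What remains,
    minus the supply rate, is the quadratic form of Phi + Sy(P^T Pi) at a suitable
    vector ([LMI_quadratic_form]), hence at most - c x_i(t)^2 for each coordinate
    ([krasovskii_strictly_dissipative]). Bessel's inequality for S, together with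
    the first matrix inequality, makes v nonnegative and bounded below by a
    multiple of x_i(t)^2 ([krasovskii_coercive]). As v is the diagonal of a bounded
    bilinear form, it is Frechet differentiable
    ([hist_quadratic_differentiable]), and dissipativity follows.

    For stability, w = 0 and the supply rate is nonpositive. Solutions are only
    absolutely continuous and satisfy the equation almost everywhere, but the
    right-hand side is then continuous in t; increments of an absolutely continuous
    function are controlled by its derivative almost everywhere
    ([abs_continuous_increment_le]), so the equation holds everywhere
    ([ae_deriv_in_everywhere], [zero_input_solution]). Thus v(x_t) decreases, which
    bounds x by the initial history ([zero_input_bound]), and since x is Lipschitz
    and v(x_t) bounded below, x(t) tends to 0 by Barbalat's argument
    ([zero_input_attractive]). *)

(** * Dot products and positive definite matrices *)

Section Dot.
Context {R : realType}.

Definition dot k (u v : 'cV[R]_k) : R := (u^T *m v) 0 0.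

Lemma dotE k (u v : 'cV[R]_k) : dot u v = \sum_i u i 0 * v i 0.
Proof. by rewrite /dot mxE; apply: eq_bigr => i _; rewrite mxE. Qed.

Lemma dotC k (u v : 'cV[R]_k) : dot u v = dot v u.
Proof. by rewrite !dotE; apply: eq_bigr => i _; rewrite mulrC. Qed.

Lemma dotDr k (u v w : 'cV[R]_k) : dot u (v + w) = dot u v + dot u w.
Proof. by rewrite /dot mulmxDr mxE. Qed.

Lemma dotNr k (u v : 'cV[R]_k) : dot u (- v) = - dot u v.
Proof. by rewrite /dot mulmxN mxE. Qed.

Lemma dotZr k (a : R) (u v : 'cV[R]_k) : dot u (a *: v) = a * dot u v.
Proof. by rewrite /dot -scalemxAr mxE. Qed.

Lemma dotDl k (u v w : 'cV[R]_k) : dot (v + w) u = dot v u + dot w u.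
Proof. by rewrite !(dotC _ u) dotDr. Qed.

Lemma dotNl k (u v : 'cV[R]_k) : dot (- v) u = - dot v u.
Proof. by rewrite !(dotC _ u) dotNr. Qed.

Lemma dotZl k (a : R) (u v : 'cV[R]_k) : dot (a *: v) u = a * dot v u.
Proof. by rewrite !(dotC _ u) dotZr. Qed.

Lemma dot0r k (u : 'cV[R]_k) : dot u 0 = 0.
Proof. by rewrite /dot mulmx0 mxE. Qed.

Lemma dot0l k (u : 'cV[R]_k) : dot 0 u = 0.
Proof. by rewrite dotC dot0r. Qed.

Lemma dot_mulmxr k l (A : 'M[R]_(k, l)) u v : dot u (A *m v) = dot (A^T *m u) v.
Proof. by rewrite /dot trmx_mul trmxK mulmxA. Qed.

Lemma dot_mulmxl k l (A : 'M[R]_(k, l)) u v : dot (A *m v) u = dot v (A^T *m u).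
Proof. by rewrite dotC dot_mulmxr dotC. Qed.

Lemma dot_col_mx k l (a c : 'cV[R]_k) (b e : 'cV[R]_l) :
  dot (col_mx a b) (col_mx c e) = dot a c + dot b e.
Proof. by rewrite /dot tr_col_mx mul_row_col mxE. Qed.

Lemma quadE k (X : 'M[R]_k) (y : 'cV[R]_k) :
  (y^T *m X *m y) 0 0 = dot y (X *m y).
Proof. by rewrite /dot mulmxA. Qed.

Lemma dot_sym k (X : 'M[R]_k) u v :
  symmetric_mx X -> dot u (X *m v) = dot v (X *m u).
Proof. by move=> sX; rewrite dot_mulmxr sX dotC. Qed.

Lemma dot_Sy k (X : 'M[R]_k) u : dot u (Sy X *m u) = 2 * dot u (X *m u).
Proof. rewrite /Sy mulmxDl dotDr [X in _ + X]dot_mulmxr trmxK dotC; ring. Qed.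

Lemma posdef_gt0 k (X : 'M[R]_k) y : posdef X -> y != 0 -> 0 < dot y (X *m y).
Proof. by case=> _ pX /pX; rewrite quadE. Qed.

Lemma posdef_ge0 k (X : 'M[R]_k) y : posdef X -> 0 <= dot y (X *m y).
Proof.
move=> pX; have [->|y0] := eqVneq y 0; first by rewrite dot0l.
exact/ltW/posdef_gt0.
Qed.

Lemma posdef_unit k (X : 'M[R]_k) : posdef X -> X \in unitmx.
Proof.
move=> pX; rewrite -unitmx_tr -row_free_unit -kermx_eq0.
apply/negPn/negP => /rowV0Pn[v /sub_kermxP vX v0].
have := @posdef_gt0 _ X v^T pX.
have -> : X *m v^T = 0 by rewrite -[X]trmxK -trmx_mul vX trmx0.
by rewrite dot0r ltxx trmx_eq0 => /(_ v0).
Qed.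

(** Cauchy-Schwarz for the inner product of X, applied to y and to the
    solution e of X e = e_i, bounds each coordinate y_i = <e, y>_X. *)
Lemma posdef_coord_bound k (X : 'M[R]_k) : posdef X ->
  exists2 c : R, 0 < c & forall (y : 'cV[R]_k) i,
    (y i 0) ^+ 2 <= c * dot y (X *m y).
Proof.
move=> pX; have sX : symmetric_mx X by case: pX.
pose e (i : 'I_k) : 'cV[R]_k := invmx X *m delta_mx i 0.
have Xe i : X *m e i = delta_mx i 0 by rewrite mulKVmx // posdef_unit.
have dote (y : 'cV[R]_k) i : dot y (X *m e i) = y i 0.
  rewrite Xe dotE (bigD1 i) //= big1 ?addr0.
    by rewrite mxE !eqxx mulr1.
  by move=> j ji; rewrite mxE (negbTE ji) mulr0.
have e0 i : e i != 0.
  apply/eqP => ei0; have := Xe i; rewrite ei0 mulmx0 => /matrixP/(_ i 0).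
  by rewrite !mxE !eqxx => /esym/eqP; rewrite oner_eq0.
pose g (i : 'I_k) := dot (e i) (X *m e i).
have g0 i : 0 < g i by exact: posdef_gt0.
have CS (y : 'cV[R]_k) i : (y i 0) ^+ 2 <= g i * dot y (X *m y).
  (* t minimizes the form of X on the line y - t e_i. *)
  set t := y i 0 / g i; have tg : t * g i = y i 0 by rewrite divfK // gt_eqF.
  have h := posdef_ge0 (y - t *: e i) pX.
  have {}h : 0 <= dot y (X *m y) - t * y i 0.
    move: h; rewrite mulmxBr -scalemxAr !(dotDr, dotDl, dotNr, dotNl, dotZl, dotZr).
    rewrite (dot_sym (e i) y sX) (dote y) -/(g i) => h; move: h tg.
    by set a := dot y _; set b := y i 0; set c := g i; nra.
  have := mulr_ge0 (ltW (g0 i)) h; rewrite mulrBr subr_ge0.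
  by congr (_ <= _); rewrite mulrA [g i * t]mulrC tg.
exists (1 + \sum_i g i) => [|y i].
  by rewrite ltr_wpDr // sumr_ge0 // => i _; exact: ltW.
apply: le_trans (CS y i) _; rewrite ler_wpM2r ?posdef_ge0 //.
rewrite (bigD1 i) //= addrCA lerDl addr_ge0 // sumr_ge0 // => j _; exact: ltW.
Qed.

End Dot.

(** * Kronecker products with the identity *)

Section Kronecker.
Context {R : realType}.

Lemma fIE d k (c : 'cV[R]_d) i j :
  fI k c i j = c (mxtens_unindex i).1 0 * ((mxtens_unindex i).2 == j)%:R.
Proof.
rewrite /fI castmxE !mxE. congr (_ * _%:R); last congr (nat_of_bool (_ == _)).
- by congr (c _ _); apply: val_inj; rewrite //= divn_small.
- by apply: val_inj; rewrite /= modn_small.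
Qed.

Lemma mul_fIE d k l (c : 'cV[R]_d) (X : 'M[R]_(k, l)) i j :
  (fI k c *m X) i j = c (mxtens_unindex i).1 0 * X (mxtens_unindex i).2 j.
Proof.
rewrite mxE (bigD1 (mxtens_unindex i).2) //= fIE eqxx mulr1 big1 ?addr0 //.
by move=> a /negbTE ai; rewrite fIE eq_sym ai mulr0 mul0r.
Qed.

(** With A = M this turns f' = M f into F' = (M (x) I) F; with A = 1 it moves a
    weight X from one side of F = f (x) I to the other. *)
Lemma tens_mul_fI d k (A : 'M[R]_d) (X : 'M[R]_k) (c : 'cV[R]_d) :
  (A *t X) *m fI k c = fI k (A *m c) *m X.
Proof.
transitivity (castmx (erefl, mul1n k) ((A *m c) *t X)); last first.
  apply/matrixP => i j; rewrite mul_fIE castmxE [LHS]mxE.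
  congr (_ * _); first by congr ((A *m c) _ _); apply: val_inj; rewrite //= divn_small.
  by congr (X _ _); apply: val_inj; rewrite //= modn_small.
have -> : (A *m c) *t X = (A *t X) *m (c *t 1%:M) by rewrite tensmx_mul mulmx1.
by rewrite castmx_mul castmx_id.
Qed.

(** Integrated over the delay interval, this produces the Kronecker product of
    the Gram matrix of f with X. *)
Lemma fI_sandwich d k (c : 'cV[R]_d) (X : 'M[R]_k) :
  fI k c *m X *m (fI k c)^T = (c *m c^T) *t X.
Proof.
apply/matrixP => i j; rewrite !mxE (bigD1 (mxtens_unindex j).2) //=.
rewrite big1 ?addr0 => [|a /negbTE aj].
  rewrite mul_fIE [X in _ * X]mxE fIE eqxx mulr1 big_ord1 !mxE; ring.
by rewrite [X in _ * X]mxE fIE eq_sym aj !mulr0.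
Qed.

End Kronecker.

(** * The matrix inequality as a quadratic form *)

Section LMI.
Context {R : realType}.

(** The LMI only tests the supply rate through an auxiliary block y paired
    with J1; at y = - J1^-1 Jt z that block contributes exactly minus the term
    z^T Jt^T J1^-1 Jt z of the supply rate (a Schur complement). *)
Lemma LMI_quadratic_form (n m d q : nat) (r : R)
  (Acl : 'M[R]_(n, n + (n + d * n) + q)) (Sigma : 'M[R]_(m, n + (n + d * n) + q))
  (F : 'M[R]_(d * n, n + (n + d * n) + q))
  (P S U : 'M[R]_n) (Q : 'M[R]_(n, d * n)) (Rm : 'M[R]_(d * n)) (FF : 'M[R]_d)
  (J1 Jt : 'M[R]_m) (J2 : 'M[R]_(m, q)) (J3 : 'M[R]_q)
  (x xr : 'cV[R]_n) (xi : 'cV[R]_(d * n)) (w : 'cV[R]_q) :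
  symmetric_mx Rm -> J1 \in unitmx ->
  let PP : 'M[R]_(n, n + (n + d * n) + q + m) :=
    row_mx (row4 P (0 : 'M[R]_n) Q (0 : 'M[R]_(n, q))) 0 in
  let Pi : 'M[R]_(n, n + (n + d * n) + q + m) := row_mx Acl 0 in
  let Phi : 'M[R]_(n + (n + d * n) + q + m) :=
    Sy (col_mx (col_mx (col_mx Q (col_mx (0 : 'M[R]_(n, d * n)) Rm))
                       (0 : 'M[R]_(q, d * n))) (0 : 'M[R]_(m, d * n))
        *m row_mx F (0 : 'M[R]_(d * n, m)))
    + Sy (col_mx (col_mx (0 : 'M[R]_(n + (n + d * n), m)) (- J2^T)) Jt
        *m row_mx Sigma (0 : 'M[R]_m))
    + dsum (dsum (dsum (S + r *: U) (dsum (- S) (- (FF *t U)))) (- J3)) J1 in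
  let chi := col_mx (col_mx x (col_mx xr xi)) w in
  let z := Sigma *m chi in
  let eta := col_mx chi (- (invmx J1 *m Jt *m z)) in
  dot eta ((Phi + Sy (PP^T *m Pi)) *m eta) + supply_rate J1 Jt J2 J3 z w =
  2 * (dot (P *m x + Q *m xi) (Acl *m chi)
       + dot (Q^T *m x + Rm *m xi) (F *m chi))
  + dot x ((S + r *: U) *m x) - dot xr (S *m xr) - dot xi ((FF *t U) *m xi).
Proof.
move=> sR uJ PP Pi Phi chi z eta.
rewrite mulmxDl dotDr dot_Sy -[PP^T *m Pi *m eta]mulmxA
  [dot eta (PP^T *m _)]dot_mulmxr trmxK.
have -> : PP *m eta = P *m x + Q *m xi.
  by rewrite /PP /eta /chi /row4 !mul_row_col !mul0mx !addr0 add0r.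
have -> : Pi *m eta = Acl *m chi by rewrite mul_row_col mul0mx addr0.
rewrite /Phi 2!mulmxDl 2![dot eta (_ + _)]dotDr !dot_Sy -!mulmxA.
rewrite [row_mx F _ *m _]mul_row_col [row_mx Sigma _ *m _]mul_row_col.
rewrite !mul0mx !addr0 -/z.
rewrite /dsum !mul_col_mx [in X in _ + X + _ + _]/eta /chi.
rewrite !(mul_row_col, mul_col_mx) !mul0mx !add0r !addr0.
rewrite -/chi /eta {1 2 3}/chi !dot_col_mx !dot0r !(addr0, add0r).
rewrite /supply_rate quadE mul_block_col dot_col_mx !dotDr.
set y : 'cV_m := - (invmx J1 *m Jt *m z).
have J1y : J1 *m y = - (Jt *m z) by rewrite mulmxN -!mulmxA mulKVmx.
have yz : dot y (Jt *m z) = - dot z (Jt^T *m invmx J1 *m Jt *m z).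
  by rewrite dotNl -!mulmxA [in RHS]dot_mulmxr trmxK dotC.
rewrite J1y !mulNmx !dotNr yz [dot w (J2^T *m z)]dot_mulmxr trmxK.
rewrite [dot z (J2 *m w)]dotC [dot (J2 *m w) z]dotC.
rewrite [dot x (Q *m _)]dot_mulmxr [dot xi (Rm *m _)]dot_mulmxr sR.
by rewrite !dotDl; ring.
Qed.

End LMI.

(** * One-sided derivatives *)

Section OneSidedDerivative.
Context {R : realType}.

(** Multiplying the difference quotient out covers h = 0 as well, which removes
    the punctured neighbourhood. *)
Lemma has_deriv_inP (V : normedModType R) (D : set R) (f : R -> V) t (l : V) :
  has_deriv_in D f t l <->
  forall e : R, 0 < e -> exists2 del : R, 0 < del &
    forall h, `|h| < del -> D (t + h) -> `|f (t + h) - f t - h *: l| <= e * `|h|.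
Proof.
split=> [fl e e0|fl].
  have /cvgrPdist_le /(_ e e0) := fl.
  rewrite near_withinE near_withinE => /nbhs_ballP[del /= del0 H].
  exists del => // h hdel Dh; have [->|h0] := eqVneq h 0.
    by rewrite addr0 subrr scale0r subr0 !normr0 mulr0.
  have := H h; rewrite /ball /= sub0r normrN => /(_ hdel h0 Dh) {}H.
  have -> : f (t + h) - f t - h *: l = - (h *: (l - h^-1 *: (f (t + h) - f t))).
    by rewrite scalerBr scalerA divff // scale1r opprB.
  by rewrite normrN normrZ mulrC ler_wpM2r.
apply/cvgrPdist_le => e e0; have [del del0 H] := fl e e0.
rewrite near_withinE near_withinE; apply/nbhs_ballP; exists del => //= h.
rewrite /ball /= sub0r normrN => hdel h0 Dh.
have := H h hdel Dh.
have -> : f (t + h) - f t - h *: l = - (h *: (l - h^-1 *: (f (t + h) - f t))).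
  by rewrite scalerBr scalerA divff // scale1r opprB.
by rewrite normrN normrZ [e * _]mulrC ler_pM2l // normr_gt0.
Qed.

Lemma has_deriv_in_cvg (V : normedModType R) (D : set R) (f : R -> V) t (l : V) :
  has_deriv_in D f t l -> f x @[x --> within D (nbhs t)] --> f t.
Proof.
move=> /has_deriv_inP/(_ 1 ltr01)[del del0 H].
apply/cvgrPdist_le => e e0; rewrite near_withinE; apply/nbhs_ballP.
pose c := 1 + `|l|; have c0 : 0 < c by rewrite ltr_pwDl.
exists (Num.min del (e / c)); first by rewrite /= lt_min del0 divr_gt0.
move=> x; rewrite /ball /= lt_min distrC => /andP[xdel xe] Dx.
have := H (x - t) xdel; rewrite addrC subrK => /(_ Dx) {}H.
rewrite distrC -(subrK ((x - t) *: l) (f x - f t)).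
rewrite (le_trans (ler_normD _ _)) // (le_trans (lerD H (lexx _))) // normrZ.
by rewrite mul1r -[X in X + _]mulr1 -mulrDr -ler_pdivlMr // ltW.
Qed.

Lemma has_deriv_in_continuous (V : normedModType R) (D : set R) (f f' : R -> V) :
  (forall t, D t -> has_deriv_in D f t (f' t)) -> {within D, continuous f}.
Proof.
by move=> H; apply/subspace_continuousP => t /H; exact: has_deriv_in_cvg.
Qed.

Lemma eq_has_deriv_in (V : normedModType R) (D : set R) (f g : R -> V) t l :
  (forall s, D s -> f s = g s) -> D t ->
  has_deriv_in D f t l -> has_deriv_in D g t l.
Proof.
move=> fg Dt /has_deriv_inP fl; apply/has_deriv_inP => e /fl[del del0 H].
by exists del => // h hdel Dh; rewrite -!fg //; exact: H.
Qed.

Lemma has_deriv_in_mxE k l (D : set R) (f : R -> 'M[R]_(k, l)) t (f' : 'M[R]_(k, l)) i j :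
  has_deriv_in D f t f' ->
  has_deriv_in D (fun s => f s i j : R^o) t (f' i j).
Proof.
rewrite /has_deriv_in => /(cvg_comp _ _)/(_ (@coord_continuous R k l i j f')).
by apply: cvg_trans; apply: near_eq_cvg; apply: nearW => h /=; rewrite !mxE.
Qed.

Lemma has_deriv_inD (D : set R) (f g : R -> R^o) t (f' g' : R) :
  has_deriv_in D f t f' -> has_deriv_in D g t g' ->
  has_deriv_in D (fun s => f s + g s : R^o) t (f' + g').
Proof.
move=> fl gl; rewrite /has_deriv_in; apply: cvg_trans (cvgD fl gl).
apply: near_eq_cvg; apply: nearW => h /=.
rewrite ?fctE /GRing.scale /=; ring.
Qed.

Lemma has_deriv_in_cst (D : set R) (c : R) t :
  has_deriv_in D (fun=> c : R^o) t 0.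
Proof.
apply/has_deriv_inP => e e0; exists 1 => // h _ _.
by rewrite subrr scaler0 subr0 normr0 mulr_ge0 // ltW.
Qed.

Lemma has_deriv_inM (D : set R) (f g : R -> R^o) t (f' g' : R) :
  has_deriv_in D f t f' -> has_deriv_in D g t g' ->
  has_deriv_in D (fun s => f s * g s : R^o) t (f' * g t + f t * g').
Proof.
move=> fl gl.
have gt : g (t + h) @[h --> within [set h | D (t + h)] (0 : R)^'] --> g t.
  apply/cvgrPdist_le => e e0.
  have /cvgrPdist_le/(_ e e0) := has_deriv_in_cvg gl.
  rewrite !near_withinE => /nbhs_ballP[del /= del0 H].
  apply/nbhs_ballP; exists del => //= h; rewrite /ball /= sub0r normrN => hd _.
  by apply: H; rewrite /ball /= opprD addNKr normrN.
apply: cvg_trans (cvgD (cvgM fl gt) (cvgM (cvg_cst (f t)) gl)).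
apply: near_eq_cvg; apply: nearW => h /=; rewrite ?fctE /GRing.scale /=; ring.
Qed.

Lemma has_deriv_in_sum (D : set R) k (f : 'I_k -> R -> R^o) t (f' : 'I_k -> R) :
  (forall i, has_deriv_in D (f i) t (f' i)) ->
  has_deriv_in D (fun s => \sum_i f i s : R^o) t (\sum_i f' i).
Proof.
elim: k f f' => [|k IH] f f' H.
  have := has_deriv_in_cst D 0 t; rewrite big_ord0; congr has_deriv_in.
  by apply/funext => s; rewrite big_ord0.
rewrite big_ord_recl.
have := has_deriv_inD (H ord0) (IH _ _ (fun i => H (lift ord0 i))).
by congr has_deriv_in; apply/funext => s; rewrite big_ord_recl.
Qed.

Lemma has_deriv_in_dot (D : set R) k (f g : R -> 'cV[R]_k) t f' g' :
  has_deriv_in D f t f' -> has_deriv_in D g t g' ->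
  has_deriv_in D (fun s => dot (f s) (g s) : R^o) t (dot f' (g t) + dot (f t) g').
Proof.
move=> fl gl; rewrite !dotE -big_split /=.
have := has_deriv_in_sum (fun i => has_deriv_inM (has_deriv_in_mxE fl (i := i) (j := 0))
                                                 (has_deriv_in_mxE gl (i := i) (j := 0))).
by congr has_deriv_in; apply/funext => s; rewrite dotE.
Qed.

Lemma mx_norm_le_entries k l (A : 'M[R]_(k, l)) (c : R) :
  0 <= c -> (forall i j, `|A i j| <= c) -> `|A| <= c.
Proof.
move=> c0 H; rewrite [leLHS]/Num.norm /= mx_normrE.
by apply/bigmax_leP; split => // -[i j] _; exact: H.
Qed.

Lemma entry_le_mx_norm k l (A : 'M[R]_(k, l)) i j : `|A i j| <= `|A|.
Proof.
rewrite [leRHS]/Num.norm /= mx_normrE; apply/bigmax_geP; right => /=.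
by exists (i, j).
Qed.

Lemma has_deriv_in_mxP k l (D : set R) (f : R -> 'M[R]_(k, l)) t (f' : 'M[R]_(k, l)) :
  (forall i j, has_deriv_in D (fun s => f s i j : R^o) t (f' i j)) ->
  has_deriv_in D f t f'.
Proof.
move=> H; apply/cvgrPdist_le => e e0.
have N (ij : 'I_k * 'I_l) : \forall h \near within [set h | D (t + h)] (0 : R)^',
    `|f' ij.1 ij.2 - h^-1 * (f (t + h) ij.1 ij.2 - f t ij.1 ij.2)| <= e.
  by have /cvgrPdist_le/(_ e e0) := H ij.1 ij.2.
move/filter_forall : N; apply: filterS => h Hh.
apply: mx_norm_le_entries => [|i j]; first exact: ltW.
by have := Hh (i, j); rewrite !mxE.
Qed.

End OneSidedDerivative.

(** * Integrals over the delay interval *)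

Section DelayIntegral.
Context {R : realType}.
Variable r : R.
Hypothesis r0 : 0 < r.

Definition icont (g : R -> R) := {within `[- r, 0], continuous g}.

Definition itg (g : R -> R) : R :=
  Rintegral lebesgue_measure `[- r, 0] g.

Lemma icont_cst c : icont (fun=> c).
Proof. by move=> x; apply: cvg_cst. Qed.

Lemma icontD f g : icont f -> icont g -> icont (fun t => f t + g t).
Proof. by move=> cf cg x; apply: cvgD; [exact: cf|exact: cg]. Qed.

Lemma icontM f g : icont f -> icont g -> icont (fun t => f t * g t).
Proof. by move=> cf cg x; apply: cvgM; [exact: cf|exact: cg]. Qed.

Lemma icontZ c g : icont g -> icont (fun t => c * g t).
Proof. by move=> cg; apply: icontM cg; exact: icont_cst. Qed.

Lemma icont_sum k (f : 'I_k -> R -> R) :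
  (forall i, icont (f i)) -> icont (fun t => \sum_i f i t).
Proof.
elim: k f => [|k IH] f H.
  rewrite (_ : (fun _ => _) = fun=> 0); first exact: icont_cst.
  by apply/funext => s; rewrite big_ord0.
rewrite (_ : (fun _ => _) = fun t => f ord0 t + \sum_i f (lift ord0 i) t).
  by apply: icontD => //; apply: IH.
by apply/funext => s; rewrite big_ord_recl.
Qed.

Lemma eq_icont f g : (forall t, t \in `[- r, 0] -> f t = g t) -> icont f -> icont g.
Proof.
move=> fg; apply: subspace_eq_continuous => t; rewrite inE => tI.
exact: fg.
Qed.

Lemma continuous_icont g : continuous g -> icont g.
Proof. exact: continuous_subspaceT. Qed.

Lemma icont_integrable g :
  icont g -> lebesgue_measure.-integrable `[- r, 0] (EFin \o g).
Proof. by apply: continuous_compact_integrable; exact: segment_compact. Qed.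

Lemma eq_itg f g : (forall t, t \in `[- r, 0] -> f t = g t) -> itg f = itg g.
Proof. by move=> fg; apply: eq_Rintegral => t; rewrite inE => /fg. Qed.

Lemma itgD f g : icont f -> icont g -> itg (fun t => f t + g t) = itg f + itg g.
Proof. by move=> cf cg; apply: RintegralD => //; exact: icont_integrable. Qed.

Lemma itgZ c g : icont g -> itg (fun t => c * g t) = c * itg g.
Proof. by move=> cg; apply: RintegralZl => //; exact: icont_integrable. Qed.

Lemma itg_cst c : itg (fun=> c) = c * r.
Proof.
rewrite /itg Rintegral_cst //; congr (_ * _).
by rewrite /= lebesgue_measure_itv /= lte_fin oppr_lt0 r0 ?add0e /= ?opprK ?add0r.
Qed.

Lemma itg_sum k (f : 'I_k -> R -> R) : (forall i, icont (f i)) ->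
  itg (fun t => \sum_i f i t) = \sum_i itg (f i).
Proof.
elim: k f => [|k IH] f H.
  rewrite big_ord0 -[RHS](mul0r r) -itg_cst.
  by apply: eq_itg => t _; rewrite big_ord0.
rewrite big_ord_recl -IH // -itgD //; last exact: icont_sum.
by apply: eq_itg => t _; rewrite big_ord_recl.
Qed.

Lemma itg_ge0 g : (forall t, t \in `[- r, 0] -> 0 <= g t) -> 0 <= itg g.
Proof. by move=> H; apply: Rintegral_ge0 => t; exact: H. Qed.

Lemma le_itg f g : icont f -> icont g ->
  (forall t, t \in `[- r, 0] -> f t <= g t) -> itg f <= itg g.
Proof.
by move=> cf cg fg; apply: le_Rintegral => //; exact: icont_integrable.
Qed.

Lemma itg_norm_le g c : icont g ->
  (forall t, t \in `[- r, 0] -> `|g t| <= c) -> `|itg g| <= c * r.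
Proof.
move=> cg H; rewrite ler_norml -mulNr -!itg_cst.
have cc (e : R) : icont (fun=> e) by exact: icont_cst.
by apply/andP; split; apply: le_itg => // t /H; rewrite ler_norml => /andP[].
Qed.

Definition mcont k l (G : R -> 'M[R]_(k, l)) := forall i j, icont (fun t => G t i j).

Lemma mcont_mulmx k l p (G : R -> 'M[R]_(k, l)) (H : R -> 'M[R]_(l, p)) :
  mcont G -> mcont H -> mcont (fun t => G t *m H t).
Proof.
move=> cG cH i j.
apply: (@eq_icont (fun t => \sum_a G t i a * H t a j)) => [t _|].
  by rewrite mxE.
by apply: icont_sum => a; exact: icontM.
Qed.

Lemma mcont_cst k l (A : 'M[R]_(k, l)) : mcont (fun=> A).
Proof. by move=> i j; exact: icont_cst. Qed.

Lemma mcont_tr k l (G : R -> 'M[R]_(k, l)) : mcont G -> mcont (fun t => (G t)^T).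
Proof.
move=> cG i j; by apply: eq_icont (cG j i) => t _; rewrite mxE.
Qed.

Lemma mcont_fI d k (f : R -> 'cV[R]_d) : mcont f -> mcont (fun t => fI k (f t)).
Proof.
move=> cf i j.
apply: (@eq_icont (fun t => f t (mxtens_unindex i).1 0 *
                            ((mxtens_unindex i).2 == j)%:R)) => [t _|].
  by rewrite fIE.
by apply: icontM; [exact: cf|exact: icont_cst].
Qed.

Lemma icont_dot k (G H : R -> 'cV[R]_k) :
  mcont G -> mcont H -> icont (fun t => dot (G t) (H t)).
Proof.
move=> cG cH.
have H1 : mcont (fun t => (G t)^T *m H t) by apply: mcont_mulmx; [exact: mcont_tr|].
exact: H1.
Qed.

Lemma eq_mint k l (G H : R -> 'M[R]_(k, l)) :
  (forall t, t \in `[- r, 0] -> G t = H t) -> mint r G = mint r H.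
Proof.
move=> GH; apply/matrixP => i j; rewrite !mxE.
by apply: eq_itg => t /GH ->.
Qed.

Lemma mintZD k l a (G H : R -> 'M[R]_(k, l)) : mcont G -> mcont H ->
  mint r (fun t => a *: G t + H t) = a *: mint r G + mint r H.
Proof.
move=> cG cH; apply/matrixP => i j; rewrite !mxE -!/(itg _) -itgZ // -itgD //.
  by apply: eq_itg => t _; rewrite !mxE.
exact: icontZ.
Qed.

Lemma mulmx_mint k l p (A : 'M[R]_(k, l)) (G : R -> 'M[R]_(l, p)) : mcont G ->
  A *m mint r G = mint r (fun t => A *m G t).
Proof.
move=> cG; apply/matrixP => i j; rewrite !mxE -/(itg _).
transitivity (itg (fun t => \sum_a A i a * G t a j)).
  rewrite itg_sum => [|a]; last exact: icontZ.
  by apply: eq_bigr => a _; rewrite mxE itgZ.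
by apply: eq_itg => t _; rewrite mxE.
Qed.

Lemma dot_mint k (u : 'cV[R]_k) (G : R -> 'cV[R]_k) : mcont G ->
  dot u (mint r G) = itg (fun t => dot u (G t)).
Proof. by move=> cG; rewrite /dot mulmx_mint // mxE. Qed.

Lemma mx_norm_mulmx k l p (A : 'M[R]_(k, l)) (B : 'M[R]_(l, p)) :
  `|A *m B| <= l%:R * (`|A| * `|B|).
Proof.
apply: mx_norm_le_entries => [|i j]; first by rewrite !mulr_ge0.
rewrite mxE (le_trans (ler_norm_sum _ _ _)) //.
have -> : l%:R * (`|A| * `|B|) = \sum_(a < l) `|A| * `|B|.
  by rewrite sumr_const card_ord mulr_natl.
by apply: ler_sum => a _; rewrite normrM ler_pM // entry_le_mx_norm.
Qed.

Lemma mx_norm_tr k l (A : 'M[R]_(k, l)) : `|A^T| <= `|A|.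
Proof.
by apply: mx_norm_le_entries => // i j; rewrite mxE entry_le_mx_norm.
Qed.

Lemma dot_norm_le k (u v : 'cV[R]_k) : `|dot u v| <= k%:R * (`|u| * `|v|).
Proof.
apply: le_trans (entry_le_mx_norm _ _ _) _.
apply: le_trans (mx_norm_mulmx _ _) _.
by rewrite ler_wpM2l // ler_wpM2r // mx_norm_tr.
Qed.

Lemma mx_norm_col_mx k l (u : 'cV[R]_k) (v : 'cV[R]_l) : 
  `|col_mx u v| <= `|u| + `|v|.
Proof.
apply: mx_norm_le_entries => [|i j]; first exact: addr_ge0.
rewrite mxE; case: (fintype.split i) => a.
  by rewrite (le_trans (entry_le_mx_norm _ _ _)) // lerDl.
by rewrite (le_trans (entry_le_mx_norm _ _ _)) // lerDr.
Qed.

Lemma mint_norm_le k l (G : R -> 'M[R]_(k, l)) (c : R) : mcont G ->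
  (forall t, t \in `[- r, 0] -> `|G t| <= c) -> `|mint r G| <= c * r.
Proof.
move=> cG H; have c0 : 0 <= c.
  apply: le_trans (H 0 _); first exact: normr_ge0.
  by rewrite in_itv /= lexx oppr_le0 ltW.
apply: mx_norm_le_entries => [|i j]; first by rewrite mulr_ge0 // ltW.
rewrite mxE; apply: itg_norm_le => // t /H.
exact/le_trans/entry_le_mx_norm.
Qed.

Lemma icont_bounded g : icont g ->
  exists2 c : R, 0 <= c & forall t, t \in `[- r, 0] -> `|g t| <= c.
Proof.
move=> cg; have ab : - r <= 0 by rewrite oppr_le0 ltW.
have [x xI Hx] := EVT_max ab cg; have [y yI Hy] := EVT_min ab cg.
exists (`|g x| + `|g y|) => [|t tI]; first exact: addr_ge0.
rewrite ler_norml; have := Hx t tI; have := Hy t tI.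
have := ler_norm (g x); have := ler_norm (- g y); rewrite normrN.
have := normr_ge0 (g x); have := normr_ge0 (g y).
by move=> *; apply/andP; split; lra.
Qed.

Lemma mcont_bounded k l (G : R -> 'M[R]_(k, l)) : mcont G ->
  exists2 c : R, 0 <= c & forall t, t \in `[- r, 0] -> `|G t| <= c.
Proof.
move=> cG.
pose c i j := sval (cid2 (icont_bounded (cG i j))).
have c0 i j : 0 <= c i j by rewrite /c; case: cid2.
have Hc i j t : t \in `[- r, 0] -> `|G t i j| <= c i j.
  by rewrite /c; case: cid2 => x /= _; exact.
exists (\sum_i \sum_j c i j) => [|t tI].
  by do 2!(apply: sumr_ge0 => ? _).
apply: mx_norm_le_entries => [|i j]; first by do 2!(apply: sumr_ge0 => ? _).
rewrite (le_trans (Hc i j t tI)) // (bigD1 i) //= (bigD1 j) //= -addrA lerDl.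
by rewrite addr_ge0 //; do ?(apply: sumr_ge0 => ? _).
Qed.

End DelayIntegral.

(** * Quadratic functionals on the history space *)

Section HistorySpace.
Context {R : realType}.
Variables (n : nat) (r : R).
Hypothesis r0 : 0 < r.
Implicit Types phi psi g h : R -> 'cV[R]_n.

Lemma mem0_itv : (0 : R) \in `[- r, 0].
Proof. by rewrite in_itv /= lexx oppr_le0 ltW. Qed.

Lemma hist_mcont phi : hist_space r phi -> mcont r phi.
Proof.
move=> cphi i j x; apply: (@continuous_comp (subspace `[- r, 0]%classic) _ _ phi
  (fun M : 'cV[R]_n => M i j) x); first exact: cphi.
exact: coord_continuous.
Qed.

Lemma hist_norm_ub phi : hist_space r phi ->
  forall t, t \in `[- r, 0] -> `|phi t| <= hist_norm r phi.
Proof.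
move=> /hist_mcont/(mcont_bounded r0)[c c0 Hc] t tI.
apply: (@ub_le_sup _ [set `|phi theta| | theta in `[- r, 0]]); last by exists t.
by exists c => _ [s sI <-]; exact: Hc.
Qed.

Lemma hist_norm_ge0 phi : hist_space r phi -> 0 <= hist_norm r phi.
Proof.
by move=> cphi; exact: le_trans (normr_ge0 _) (hist_norm_ub cphi mem0_itv).
Qed.

Lemma hist_space_lin a g h :
  hist_space r g -> hist_space r h -> hist_space r (a *: g + h).
Proof.
move=> cg ch x; apply: cvgD; last exact: ch.
by apply: cvgZr; exact: cg.
Qed.

Definition hist_bilinear (B : (R -> 'cV[R]_n) -> (R -> 'cV[R]_n) -> R) : Prop :=
  [/\ forall a phi g h, hist_space r phi -> hist_space r g -> hist_space r h ->
        B phi (a *: g + h) = a * B phi g + B phi h,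
      forall phi psi, hist_space r phi -> hist_space r psi ->
        B phi psi = B psi phi &
      exists2 c : R, 0 < c & forall phi psi, hist_space r phi ->
        hist_space r psi -> `|B phi psi| <= c * (hist_norm r phi * hist_norm r psi)].

(** The differential at phi is h |-> 2 B phi h, and the remainder B h h is
    quadratically small because B is bounded. *)
Lemma hist_quadratic_differentiable B : hist_bilinear B ->
  hist_differentiable r (fun phi => B phi phi).
Proof.
move=> [lin sym [c c0 bnd]] phi sphi; exists (fun h => 2 * B phi h); split.
- by move=> a g h sg sh; rewrite lin //; ring.
- exists (2 * (c * hist_norm r phi)) => h sh.
  by rewrite normrM ger0_norm // -!mulrA ler_pM2l // bnd.
move=> e e0; exists (e / c) => [|h sh hd]; first exact: divr_gt0.
have sph : hist_space r (phi + h) by rewrite -[phi]scale1r; exact: hist_space_lin.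
have BD psi : hist_space r psi -> B psi (phi + h) = B psi phi + B psi h.
  by move=> spsi; rewrite -{1}[phi]scale1r lin // mul1r.
have -> : B (phi + h) (phi + h) - B phi phi - 2 * B phi h = B h h.
  rewrite BD // (sym _ phi) // (sym _ h) // !BD // (sym h phi) //; ring.
apply: le_trans (bnd _ _ sh sh) _; rewrite mulrA ler_wpM2r ?hist_norm_ge0 //.
by rewrite mulrC -ler_pdivlMr.
Qed.

End HistorySpace.

(** * The Krasovskii functional *)

Section Functional.
Context {R : realType}.
Variables (n d : nat) (r : R) (f : R -> 'cV[R]_d).
Hypothesis r0 : 0 < r.
Hypothesis cf : mcont r f.
Variables (P S U : 'M[R]_n) (Q : 'M[R]_(n, d * n)) (Rm : 'M[R]_(d * n)).
Hypotheses (sP : symmetric_mx P) (sR : symmetric_mx Rm).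
Hypotheses (sS : symmetric_mx S) (sU : symmetric_mx U).
Implicit Types phi psi : R -> 'cV[R]_n.

(** The distributed delay term int F(tau) phi(tau) dtau: the moments of phi
    against the entries of f. *)
Definition fmoment (phi : R -> 'cV[R]_n) : 'cV[R]_(d * n) :=
  mint r (fun tau => fI n (f tau) *m phi tau).

(** Polarized, so that boundedness of one bilinear form yields at once the
    differentiability of [krasovskii] and its bound by the squared norm. The
    weight grows from S at -r to S + r U at 0. *)
Definition krasovskii_form (phi psi : R -> 'cV[R]_n) : R :=
  dot (col_mx (phi 0) (fmoment phi))
      (block_mx P Q Q^T Rm *m col_mx (psi 0) (fmoment psi)) +
  itg r (fun tau => dot (phi tau) ((S + (tau + r) *: U) *m psi tau)).

Definition krasovskii (phi : R -> 'cV[R]_n) : R := krasovskii_form phi phi.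

Lemma mcont_fmul phi : mcont r phi -> mcont r (fun tau => fI n (f tau) *m phi tau).
Proof. by move=> cphi; apply: mcont_mulmx => //; exact: mcont_fI. Qed.

Lemma mcont_weight : @mcont R r n n (fun tau => S + (tau + r) *: U).
Proof.
move=> i j; apply: (@eq_icont _ _ (fun t => S i j + (t + r) * U i j)) => [t _|].
  by rewrite !mxE.
apply: icontD; first exact: icont_cst.
apply: icontM; last exact: icont_cst.
by apply: continuous_icont => x; apply: cvgD; [exact: cvg_id|exact: cvg_cst].
Qed.

Lemma icont_weight phi psi : mcont r phi -> mcont r psi ->
  icont r (fun tau => dot (phi tau) ((S + (tau + r) *: U) *m psi tau)).
Proof.
move=> c1 c2; apply: icont_dot => //.
by apply: mcont_mulmx => //; exact: mcont_weight.
Qed.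

Lemma fmoment_norm_le : exists2 c : R, 0 <= c & forall phi, hist_space r phi ->
  `|fmoment phi| <= c * hist_norm r phi.
Proof.
have [c c0 Hc] := mcont_bounded r0 (mcont_fI (k := n) cf).
exists (n%:R * c * r) => [|phi sphi]; first by rewrite !mulr_ge0 // ltW.
have cphi := hist_mcont sphi.
rewrite mulrAC; apply: mint_norm_le => // [|t tI]; first exact: mcont_fmul.
rewrite (le_trans (mx_norm_mulmx _ _)) // -mulrA ler_wpM2l // ler_pM //.
  exact: Hc.
exact: hist_norm_ub.
Qed.

Lemma krasovskii_bilinear : hist_bilinear r krasovskii_form.
Proof.
have cm := @hist_mcont R n r.
split.
- move=> a phi g h sphi sg sh; rewrite /krasovskii_form.
  have -> : fmoment (a *: g + h) = a *: fmoment g + fmoment h.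
    rewrite /fmoment -mintZD; try by apply: mcont_fmul; exact: cm.
    by apply: eq_mint => t _; rewrite mulmxDr scalemxAr.
  rewrite (_ : col_mx ((a *: g + h) 0) _ = a *: col_mx (g 0) (fmoment g) +
    col_mx (h 0) (fmoment h)); last by rewrite scale_col_mx add_col_mx.
  rewrite mulmxDr -scalemxAr dotDr dotZr.
  rewrite (_ : itg r _ = a * itg r (fun tau =>
     dot (phi tau) ((S + (tau + r) *: U) *m g tau)) + itg r (fun tau =>
     dot (phi tau) ((S + (tau + r) *: U) *m h tau))); first by ring.
  have cg := icont_weight (cm _ sphi) (cm _ sg).
  have ch := icont_weight (cm _ sphi) (cm _ sh).
  rewrite -itgZ // -itgD //; last exact: icontZ.
  by apply: eq_itg => t _; rewrite mulmxDr dotDr -scalemxAr dotZr.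
- move=> phi psi sphi spsi; rewrite /krasovskii_form dot_sym; last first.
    by rewrite /symmetric_mx tr_block_mx trmxK sP sR.
  congr (_ + _); apply: eq_itg => t _; apply: dot_sym.
  by rewrite /symmetric_mx !linearD !linearZ /= sS sU.
have [c c0 Hc] := fmoment_norm_le; have [b b0 Hb] := mcont_bounded r0 mcont_weight.
set H := block_mx P Q Q^T Rm.
pose e := (n + d * n)%:R * ((1 + c) * ((n + d * n)%:R * (`|H| * (1 + c)))).
pose e' := n%:R * (n%:R * b) * r.
have e0 : 0 <= e by rewrite !mulr_ge0 // addr_ge0.
have e'0 : 0 <= e' by rewrite !mulr_ge0 // ltW.
exists (1 + (e + e')) => [|phi psi sphi spsi]; first by rewrite ltr_pwDl // addr_ge0.
have Y0 g : hist_space r g -> `|col_mx (g 0) (fmoment g)| <= (1 + c) * hist_norm r g.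
  move=> sg; rewrite (le_trans (mx_norm_col_mx _ _)) // mulrDl mul1r lerD //.
    by apply: hist_norm_ub => //; exact: mem0_itv.
  exact: Hc.
rewrite mulrDl mul1r ler_wpDl ?mulr_ge0 ?hist_norm_ge0 //.
rewrite (le_trans (ler_normD _ _)) // mulrDl lerD //.
  rewrite (le_trans (dot_norm_le _ _)) //.
  have -> : e * (hist_norm r phi * hist_norm r psi) =
    (n + d * n)%:R * (((1 + c) * hist_norm r phi) *
      ((n + d * n)%:R * (`|H| * ((1 + c) * hist_norm r psi)))) by rewrite /e; ring.
  rewrite ler_wpM2l // ler_pM ?Y0 //.
  rewrite (le_trans (mx_norm_mulmx _ _)) // ler_wpM2l // ler_wpM2l // Y0 //.
have -> : e' * (hist_norm r phi * hist_norm r psi) =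
  n%:R * (hist_norm r phi * (n%:R * (b * hist_norm r psi))) * r by rewrite /e'; ring.
apply: itg_norm_le => // [|t tI]; first exact: icont_weight (cm _ sphi) (cm _ spsi).
rewrite (le_trans (dot_norm_le _ _)) // ler_wpM2l // ler_pM ?hist_norm_ub //.
rewrite (le_trans (mx_norm_mulmx _ _)) // ler_wpM2l // ler_pM ?hist_norm_ub //.
exact: Hb.
Qed.

Lemma eq_krasovskii phi psi :
  (forall tau, tau \in `[- r, 0] -> phi tau = psi tau) ->
  krasovskii phi = krasovskii psi.
Proof.
move=> E; rewrite /krasovskii /krasovskii_form.
have -> : fmoment phi = fmoment psi by apply: eq_mint => t /E ->.
by rewrite E ?mem0_itv //; congr (_ + _); apply: eq_itg => t /E ->.
Qed.

(** Bessel's inequality: expand the nonnegative integral of the quadratic form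
    of S at phi - F^T (G^-1 (x) I) xi, the distance of phi to its projection
    on the span of the entries of f, whose Gram matrix is G. *)
Lemma fmoment_bessel (X : 'M[R]_n) phi : posdef X ->
  posdef (mint r (fun tau => f tau *m (f tau)^T)) -> mcont r phi ->
  dot (fmoment phi)
    ((invmx (mint r (fun tau => f tau *m (f tau)^T)) *t X) *m fmoment phi) <=
  itg r (fun tau => dot (phi tau) (X *m phi tau)).
Proof.
move=> pX pG cphi; set G := mint _ _; have sX : symmetric_mx X by case: pX.
have uG : G \in unitmx by exact: posdef_unit.
have sG : (invmx G)^T = invmx G by rewrite trmx_inv; case: pG => ->.
pose xi := fmoment phi; pose zeta := (invmx G *t 1%:M) *m xi.
pose F t := fI n (f t); have cF : mcont r F by exact: mcont_fI.
have cc k l (A : 'M[R]_(k, l)) : mcont r (fun=> A) by exact: mcont_cst.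
have mX : mcont r (fun t => X *m phi t) by exact: mcont_mulmx.
have i1 : icont r (fun t => dot (phi t) (X *m phi t)) by exact: icont_dot.
have mE : mcont r (fun t => F t *m (X *m phi t)) by exact: mcont_mulmx.
have i2 : icont r (fun t => dot zeta (F t *m (X *m phi t))) by exact: icont_dot.
have mF : mcont r (fun t => (F t *m X *m (F t)^T) *m zeta).
  apply: mcont_mulmx => //; apply: mcont_mulmx; last exact: mcont_tr.
  exact: mcont_mulmx.
have i3 : icont r (fun t => dot zeta ((F t *m X *m (F t)^T) *m zeta)).
  exact: icont_dot.
have E2 : itg r (fun t => dot zeta (F t *m (X *m phi t))) =
    dot xi ((invmx G *t X) *m xi).
  rewrite -dot_mint //.
  have -> : mint r (fun t => F t *m (X *m phi t)) = (1%:M *t X) *m xi.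
    rewrite (mulmx_mint r0); last exact: mcont_fmul.
    apply: eq_mint => t _.
    by rewrite mulmxA [in RHS]mulmxA tens_mul_fI mul1mx.
  rewrite /zeta. rewrite dot_mulmxl trmx_tens trmx1 sG mulmxA tensmx_mul.
  by rewrite mulmx1 mul1mx.
have E3 : itg r (fun t => dot zeta ((F t *m X *m (F t)^T) *m zeta)) =
    dot xi ((invmx G *t X) *m xi).
  rewrite -dot_mint //.
  have -> : mint r (fun t => (F t *m X *m (F t)^T) *m zeta) = (G *t X) *m zeta.
    apply/matrixP => i j; rewrite [in RHS]mxE mxE -/(itg r _).
    transitivity (itg r (fun t => \sum_a ((f t *m (f t)^T) *t X) i a * zeta a j)).
      by apply: eq_itg => t _; rewrite mxE fI_sandwich.
    have ct a : icont r (fun t => ((f t *m (f t)^T) *t X) i a).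
      apply: (@eq_icont _ _ (fun t => X (mxtens_unindex i).2 (mxtens_unindex a).2 *
        (f t *m (f t)^T) (mxtens_unindex i).1 (mxtens_unindex a).1)) => [t _|].
        by rewrite [RHS]mxE mulrC.
      by apply: icontZ; apply: mcont_mulmx => //; exact: mcont_tr.
    rewrite (itg_sum r0) => [|a]; last by apply: icontM => //; exact: icont_cst.
    apply: eq_bigr => a _.
    have -> : (G *t X) i a * zeta a j =
        X (mxtens_unindex i).2 (mxtens_unindex a).2 * zeta a j *
        itg r (fun t => (f t *m (f t)^T) (mxtens_unindex i).1 (mxtens_unindex a).1).
      rewrite [(G *t X) _ _]mxE [G _ _]mxE -/(itg r _); ring.
    rewrite -itgZ; last by apply: mcont_mulmx => //; exact: mcont_tr.
    apply: eq_itg => t _; rewrite [(_ *t _) _ _]mxE; ring.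
  rewrite /zeta dot_mulmxl trmx_tens trmx1 sG !mulmxA !tensmx_mul.
  by rewrite mulVmx // mul1mx mulmx1 mul1mx. 
have : 0 <= itg r (fun t => dot (phi t - (F t)^T *m zeta)
                               (X *m (phi t - (F t)^T *m zeta))).
  by apply: itg_ge0 => t _; exact: posdef_ge0.
rewrite (_ : itg r _ = itg r (fun t => dot (phi t) (X *m phi t)) +
   ((-2) * itg r (fun t => dot zeta (F t *m (X *m phi t))) +
   itg r (fun t => dot zeta ((F t *m X *m (F t)^T) *m zeta)))).
  rewrite E2 E3 -/xi; lra.
rewrite -itgZ // -itgD //; last exact: icontZ.
rewrite -itgD //; last by apply: icontD => //; exact: icontZ.
apply: eq_itg => t _; rewrite mulmxBr !(dotDl, dotDr, dotNl, dotNr).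
rewrite (dot_sym (phi t) ((F t)^T *m zeta) sX) -!mulmxA.
rewrite !(dot_mulmxl (F t)^T) trmxK; ring.
Qed.

End Functional.

(** * Differentiating a delay integral *)

Section Leibniz.
Context {R : realType}.

Lemma derive_has_deriv_in (D : set R) (f : R -> R^o) (t l : R) :
  is_derive t 1 f l -> has_deriv_in D f t l.
Proof.
move=> fl.
have H0 : h^-1 *: ((f \o shift t) (h *: (1 : R)) - f t) @[h --> (0 : R)^'] --> l.
  by rewrite -(@derive_val _ _ _ _ _ _ _ fl); exact: (@ex_derive _ _ _ _ _ _ _ fl).
have /cvgrPdist_le H : h^-1 *: (f (t + h) - f t) @[h --> (0 : R)^'] --> l.
  apply: cvg_trans H0; apply: near_eq_cvg; apply: nearW => h /=.
  by rewrite scaler1 [h + t]addrC.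
apply/cvgrPdist_le => e /H; rewrite !near_withinE.
by apply: filterS => h Hh h0 _; exact: Hh.
Qed.

Lemma has_deriv_in_derive (D : set R) (f : R -> R^o) (t l : R) :
  nbhs t D -> has_deriv_in D f t l -> is_derive t 1 f l.
Proof.
move=> /nbhs_ballP[d /= d0 Hd] fl.
have H : h^-1 *: ((f \o shift t) (h *: (1 : R)) - f t) @[h --> (0 : R)^'] --> l.
  apply/cvgrPdist_le => e e0; have /cvgrPdist_le/(_ e e0) := fl.
  rewrite !near_withinE => /nbhs_ballP[d' /= d'0 Hd'].
  apply/nbhs_ballP; exists (Num.min d d') => [|h]; first by rewrite /= lt_min d0.
  rewrite /ball /= sub0r normrN lt_min => /andP[hd hd'] h0.
  rewrite /= scaler1 [h + t]addrC; apply: Hd' => //.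
    by rewrite /ball /= sub0r normrN.
  by apply: Hd; rewrite /ball /= opprD addNKr normrN.
by apply: DeriveDef; [apply/cvg_ex; exists l | apply/cvg_lim].
Qed.

Variable r : R.
Hypothesis r0 : 0 < r.

(** The form in which integration by parts takes differentiability on a closed
    interval. *)
Lemma has_deriv_in_oo_LR (a b : R -> R) :
  (forall t, t \in `[- r, 0] -> has_deriv_in `[- r, 0] (a : R -> R^o) t (b t)) ->
  derivable_oo_LRcontinuous a (- r) 0 /\ {in `]- r, 0[, derive1 a =1 b}.
Proof.
move=> ab; have ca : {within `[- r, 0], continuous a}.
  by apply: (@has_deriv_in_continuous _ R^o _ a b) => t; exact: ab.
have D t : t \in `]- r, 0[ -> is_derive t 1 (a : R -> R^o) (b t).
  move=> tI; apply: (@has_deriv_in_derive `[- r, 0]%classic).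
    apply: (@filterS _ _ _ `]- r, 0[%classic); first exact: subset_itv_oo_cc.
    by apply: open_nbhs_nbhs; split => //; exact: interval_open.
  by apply: ab; exact: subset_itv_oo_cc.
have nr0 : - r < 0 by rewrite oppr_lt0.
have [_ cl cr] := (continuous_within_itvP a nr0).1 ca.
split; first by split => // t /D[].
by move=> t /D dt; rewrite derive1E derive_val.
Qed.

Lemma has_deriv_in_setT (D : set R) (h : R -> R^o) (t l : R) :
  has_deriv_in setT h t l -> has_deriv_in D h t l.
Proof.
move=> hl; apply: derive_has_deriv_in; apply: has_deriv_in_derive hl.
exact: filterT.
Qed.

Lemma has_deriv_in_shift (D : set R) (h : R -> R^o) (s t l : R) :
  has_deriv_in setT h (s + t) l -> has_deriv_in D (fun x => h (s + x)) t l.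
Proof.
move=> hl; apply: has_deriv_in_setT; move: hl; rewrite /has_deriv_in.
by under eq_fun do rewrite -addrA.
Qed.

(** Integrating by parts trades g, which is only continuous, for its primitive
    G, whose translates may be differentiated under the integral sign. *)
Lemma delay_integral_deriv (a b g : R -> R) (D : set R) (t : R) :
  (forall s, s \in `[- r, 0] -> has_deriv_in `[- r, 0] (a : R -> R^o) s (b s)) ->
  icont r b -> continuous g ->
  has_deriv_in D (fun s => itg r (fun tau => a tau * g (s + tau)) : R^o) t
    (a 0 * g t - a (- r) * g (t - r) - itg r (fun tau => b tau * g (t + tau))).
Proof.
move=> ab cb cg; have [ao a'b] := has_deriv_in_oo_LR ab.
pose c := t - r - 1; pose G s := \int[lebesgue_measure]_(x in `[c, s]) g x.
have Gd s : s \in `]c, (t + 1)[ -> has_deriv_in setT (G : R -> R^o) s (g s).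
  rewrite in_itv /= => /andP[cs st]; apply: derive_has_deriv_in.
  have ig : lebesgue_measure.-integrable `[c, t + 1] (EFin \o g).
    apply: continuous_compact_integrable; first exact: segment_compact.
    exact: continuous_subspaceT.
  have [d1 d2] := @continuous_FTC1_closed R g c s (t + 1) st ig cs (cg s).
  by apply: DeriveDef => //; rewrite -derive1E.
have sin s tau : s \in `]t - 1, t + 1[ -> tau \in `[- r, 0] ->
    s + tau \in `]c, (t + 1)[.
  by rewrite !in_itv /= /c => /andP[? ?] /andP[? ?]; apply/andP; split; lra.
have Gs s : s \in `]t - 1, t + 1[ -> forall tau, tau \in `[- r, 0] ->
    has_deriv_in `[- r, 0] (fun x => G (s + x) : R^o) tau (g (s + tau)).
  by move=> sI tau tI; apply: has_deriv_in_shift; apply: Gd; exact: sin.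
have cGs s : s \in `]t - 1, t + 1[ -> icont r (fun x => G (s + x)).
  by move=> sI; apply: (@has_deriv_in_continuous _ R^o _ _ _ (Gs _ sI)).
have cgs s : icont r (fun x => g (s + x)).
  apply: continuous_icont => x; apply: (@continuous_comp _ _ _ (fun x => s + x) g).
    by apply: cvgD; [exact: cvg_cst|exact: cvg_id].
  exact: cg.
have nr0 : - r < 0 by rewrite oppr_lt0.
have parts s : s \in `]t - 1, t + 1[ ->
  a 0 * G s - a (- r) * G (s - r) - itg r (fun tau => b tau * G (s + tau)) =
  itg r (fun tau => a tau * g (s + tau)).
  move=> sI; have [Go G'g] := has_deriv_in_oo_LR (Gs _ sI).
  rewrite {2}/itg (Rintegration_by_parts nr0 cb ao a'b (cgs s) Go G'g).
  by rewrite addr0.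
have tI : t \in `]t - 1, t + 1[ by rewrite in_itv /=; apply/andP; split; lra.
have dbG : has_deriv_in setT (fun s => itg r (fun tau => b tau * G (s + tau)) : R^o)
    t (itg r (fun tau => b tau * g (t + tau))).
  have dbGs s tau : s \in `]t - 1, t + 1[ -> tau \in `[- r, 0] ->
      is_derive s (1 : R) (fun s => b tau * G (s + tau) : R^o) (b tau * g (s + tau)).
    move=> sI tauI; apply: (@has_deriv_in_derive setT); first exact: filterT.
    have dG : has_deriv_in setT (fun s => G (s + tau) : R^o) s (g (s + tau)).
      under eq_fun do rewrite addrC.
      by apply: has_deriv_in_shift; rewrite addrC; apply: Gd; exact: sin.
    by have := has_deriv_inM (has_deriv_in_cst setT (b tau) s) dG; rewrite mul0r add0r.
  have pE s tau : s \in `]t - 1, t + 1[ -> tau \in `[- r, 0] ->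
      partial1of2 (fun s tau => b tau * G (s + tau)) s tau = b tau * g (s + tau).
    by move=> sI tauI; rewrite partial1of2E; have [] := dbGs s tau sI tauI.
  have [cb' cb'0 Hcb] := icont_bounded r0 cb.
  have ctg : {within `[c, t + 1], continuous g} by exact: continuous_subspaceT.
  have ct1 : c <= t + 1 by rewrite /c; lra.
  have [x xI Hx] := EVT_max ct1 ctg; have [y yI Hy] := EVT_min ct1 ctg.
  have Hg s : s \in `[c, t + 1] -> `|g s| <= `|g x| + `|g y|.
    move=> sI; rewrite ler_norml; have := Hx s sI; have := Hy s sI.
    have := ler_norm (g x); have := ler_norm (- g y); rewrite normrN.
    have := normr_ge0 (g x); have := normr_ge0 (g y).
    by move=> *; apply/andP; split; lra.
  (* K bounds the derivatives of b times the translates of G near t, hence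
     dominates the difference quotients. *)
  pose K := cb' * (`|g x| + `|g y|).
  have K0 : 0 <= K by rewrite mulr_ge0 // addr_ge0.
  have ii s : s \in `]t - 1, t + 1[ ->
      lebesgue_measure.-integrable `[- r, 0] (EFin \o (fun tau => b tau * G (s + tau))).
    by move=> sI; apply: icont_integrable; apply: icontM => //; exact: cGs.
  have iK : lebesgue_measure.-integrable `[- r, 0] (EFin \o (fun _ : R => K)).
    by apply: icont_integrable; exact: icont_cst.
  have mI : measurable (`[- r, 0]%classic : set R) by exact: measurable_itv.
  have dG s tau : `]t - 1, t + 1[%classic s -> `[- r, 0]%classic tau ->
      derivable (fun s => b tau * G (s + tau)) s 1.
    by move=> sI tauI; have [] := dbGs s tau sI tauI.
  have Kub s tau : `]t - 1, t + 1[%classic s -> `[- r, 0]%classic tau ->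
      `|partial1of2 (fun s tau => b tau * G (s + tau)) s tau| <= K.
    move=> sI tauI; rewrite pE // normrM ler_pM //; first exact: Hcb.
    by apply: Hg; apply: subset_itv_oo_cc; exact: sin.
  have := @cvg_differentiation_under_integral R _ _ lebesgue_measure
    (fun s tau => b tau * G (s + tau)) `[- r, 0]%classic mI t (t - 1) (t + 1) tI ii
    dG (fun=> K) (fun=> K0) iK Kub.
  have -> : \int[lebesgue_measure]_(tau in `[- r, 0])
      partial1of2 (fun s tau => b tau * G (s + tau)) t tau =
      itg r (fun tau => b tau * g (t + tau)).
    by apply: eq_itg => tau; exact: pE.
  move=> /cvgrPdist_le H; apply/cvgrPdist_le => e /H; rewrite !near_withinE.
  by apply: filterS => h Hh h0 _; rewrite [t + h]addrC; exact: Hh.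
pose k s := a 0 * G s - a (- r) * G (s - r) -
  itg r (fun tau => b tau * G (s + tau)).
have dk : has_deriv_in setT (k : R -> R^o) t (a 0 * g t - a (- r) * g (t - r) -
    itg r (fun tau => b tau * g (t + tau))).
  have tI0 : t \in `]c, (t + 1)[ by rewrite in_itv /= /c; apply/andP; split; lra.
  have h0 := Gd t tI0.
  have h1 : has_deriv_in setT (fun s => G (s - r) : R^o) t (g (t - r)).
    under eq_fun do rewrite addrC.
    apply: has_deriv_in_shift; rewrite addrC; apply: Gd; apply: sin => //.
    by rewrite in_itv /= lexx ltW.
  have := has_deriv_inD (has_deriv_inD
    (has_deriv_inM (has_deriv_in_cst setT (a 0) t) h0)
    (has_deriv_inM (has_deriv_in_cst setT (- a (- r)) t) h1))
    (has_deriv_inM (has_deriv_in_cst setT (-1) t) dbG).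
  rewrite !mul0r !add0r mulN1r mulNr; congr has_deriv_in.
  by apply/funext => s; rewrite mulN1r mulNr.
apply: derive_has_deriv_in; apply: (@has_deriv_in_derive `]t - 1, t + 1[%classic).
  by apply: open_nbhs_nbhs; split => //; exact: interval_open.
by apply: (eq_has_deriv_in parts tI); exact: has_deriv_in_setT.
Qed.

End Leibniz.

(** * Increments of functions differentiable almost everywhere *)

Section AbsolutelyContinuous.
Context {R : realType}.

(** Following the supremum of the points reached by X replaces the choice of a
    tagged partition finer than a gauge (Cousin's lemma). *)
Lemma interval_induction (a b : R) (X : R -> Prop) : a <= b -> X a ->
  (forall s, a <= s <= b -> exists2 del : R, 0 < del & forall c c',
     s - del < c -> c <= s -> s <= c' -> c' < s + del -> a <= c -> c' <= b ->
     X c -> X c') ->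
  X b.
Proof.
move=> ab Xa step; pose A := [set c | a <= c <= b /\ X c].
have A_sup : has_sup A.
  by split; [exists a; rewrite /A /= lexx ab|exists b => c [/andP[]]].
have aA : A a by rewrite /A /= lexx ab.
have as_ : a <= sup A by apply: ub_le_sup aA; case: A_sup.
have sb : sup A <= b by apply: ge_sup; [exists a|move=> c [/andP[]]].
have [|del del0 H] := step (sup A); first by rewrite as_.
have [c [/andP[ac cb] Xc] cs] := sup_adherent del0 A_sup.
have csA : c <= sup A by apply: ub_le_sup; [case: A_sup|split; [rewrite ac|]].
pose c' := Num.min b (sup A + del / 2).
have sc' : sup A <= c' by rewrite le_min sb lerDl divr_ge0 // ltW.
have Xc' : X c'.
  apply: (H c) => //; last by rewrite ge_min lexx.
  by rewrite gt_min ltrD2l ltr_pdivrMr // ltr_pMr // ltr1n orbT.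
have : c' <= sup A.
  apply: ub_le_sup; first by case: A_sup.
  by split=> //; rewrite (le_trans as_ sc') ge_min lexx.
rewrite ge_min => /orP[bs|]; last by rewrite gerDl leNgt divr_gt0.
by move: Xc'; rewrite /c' min_l // (le_trans bs) // lerDl divr_ge0 // ltW.
Qed.

Lemma abs_continuous_sub (V : normedModType R) (a b a' b' : R) (h : R -> V) :
  a <= a' -> b' <= b -> abs_continuous a b h -> abs_continuous a' b' h.
Proof.
move=> aa bb ac e /ac[del del0 H]; exists del => // k l u lu; apply: H => i.
have [al [? ub]] := lu i; split; first exact: le_trans al.
by split=> //; exact: le_trans bb.
Qed.

Lemma abs_continuous_mxE k l (a b : R) (h : R -> 'M[R]_(k, l)) i j :
  abs_continuous a b h -> abs_continuous a b (fun t => h t i j : R^o).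
Proof.
move=> ac e /ac[del del0 H]; exists del => // m lo up lu dis small.
apply: le_lt_trans (H _ _ _ lu dis small); apply: ler_sum => a' _.
apply: le_trans (entry_le_mx_norm _ i j); by rewrite !mxE.
Qed.

Lemma abs_continuousN (a b : R) (h : R -> R^o) :
  abs_continuous a b h -> abs_continuous a b (fun t => - h t : R^o).
Proof.
move=> ac e /ac[del del0 H]; exists del => // m lo up lu dis small.
apply: le_lt_trans (H _ _ _ lu dis small); apply: ler_sum => a' _.
by rewrite -opprD normrN.
Qed.

(** The estimates on both sides of s add up because u <= s <= v; they would not
    control increments between two points on the same side. *)
Lemma has_deriv_in_straddle (D : set R) (h : R -> R^o) (s l c e : R) :
  has_deriv_in D h s l -> l <= c -> 0 < e ->
  exists2 del : R, 0 < del & forall u v, s - del < u -> u <= s -> s <= v ->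
    v < s + del -> D u -> D v -> h v - h u <= (c + e) * (v - u).
Proof.
move=> /has_deriv_inP fl lc e0; have [d d0 Hd] := fl e e0.
exists d => // u v du us sv vd Du Dv.
have I1 : h v - h s - (v - s) * l <= e * (v - s).
  have := Hd (v - s); rewrite [s + (v - s)]addrC subrK ger0_norm ?subr_ge0 //.
  rewrite ltrBlDl => /(_ vd)/(_ Dv) H.
  exact: le_trans (ler_norm _) H.
have I2 : h s - h u - (s - u) * l <= e * (s - u).
  have E1 : `|u - s| = s - u by rewrite distrC ger0_norm ?subr_ge0.
  have := Hd (u - s); rewrite E1 [s + (u - s)]addrC subrK.
  rewrite ltrBlDr -ltrBlDl => /(_ du)/(_ Du) H.
  apply: le_trans H.
  rewrite -normrN; apply: le_trans (ler_norm _); rewrite /GRing.scale /=; lra.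
have I3 : (v - u) * l <= (v - u) * c.
  by rewrite ler_wpM2l // subr_ge0 (le_trans us).
lra.
Qed.

(** Interval induction glues the straddle estimates, of slope c + e' for
    arbitrarily small e'. *)
Lemma deriv_in_increment_le (D : set R) (h : R -> R^o) (a b c : R) :
  a <= b -> (forall t, a <= t <= b -> D t) ->
  (forall t, a <= t <= b -> exists2 l, has_deriv_in D h t l & l <= c) ->
  h b - h a <= c * (b - a).
Proof.
move=> ab abD H; apply/ler_addgt0Pr => e e0.
pose e' := e / (1 + (b - a)).
have d0 : 0 < 1 + (b - a) by rewrite ltr_pwDl // subr_ge0.
have e'0 : 0 < e' by exact: divr_gt0.
apply: (@le_trans _ _ ((c + e') * (b - a))).
  apply: (@interval_induction a b (fun t => h t - h a <= (c + e') * (t - a))) => //.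
    by rewrite !subrr mulr0.
  move=> s sab; have [l hl lc] := H s sab.
  have [del del0 Hd] := has_deriv_in_straddle hl lc e'0.
  exists del => // u v du us sv vd au vb Hu.
  have uv : u <= v by exact: le_trans sv.
  have := Hd u v du us sv vd (abD _ _) (abD _ _).
  rewrite au vb (le_trans uv) // (le_trans au) // => /(_ isT isT); lra.
have : e' * (b - a) <= e.
  by rewrite mulrAC ler_pdivrMr // ler_pM2l // lerDr.
lra.
Qed.

(** Cover the exceptional null set by an open set U of small measure. Where the
    tag of an interval lies outside U, the derivative controls the increment;
    the intervals inside U are collected in a family (lo, up) of small total
    length, whose increments are small by absolute continuity. *)
Lemma abs_continuous_increment_le (D : set R) (h : R -> R^o) (a b c : R) :
  a <= b -> (forall t, a <= t <= b -> D t) -> abs_continuous a b h ->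
  {ae lebesgue_measure, forall t : R, a <= t <= b ->
     exists2 l, has_deriv_in D h t l & l <= c} ->
  h b - h a <= c * (b - a).
Proof.
move=> ab abD ac [N [mN N0' NP]].
have N0 : lebesgue_measure N = 0%E by exact: N0'.
(* Subtracting the slope c reduces the claim to k b <= k a. *)
pose k t := h t - c * t.
suff main e : 0 < e -> k b - k a <= e * (b - a) + (e + `|c| * e).
  suff : k b - k a <= 0 by rewrite /k; lra.
  apply/ler_addgt0Pr => e e0; rewrite add0r.
  pose d := b - a + 1 + `|c|.
  have d0 : 0 < d by rewrite /d -addrA ltr_wpDl ?subr_ge0 // ltr_pwDl.
  apply: le_trans (main (e / d) _) _; first exact: divr_gt0.
  have -> : e / d * (b - a) + (e / d + `|c| * (e / d)) = e / d * d by rewrite /d; ring.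
  by rewrite divfK // gt_eqF.
move=> e0; have [del del0 Hdel] := ac e e0.
pose del' := Num.min del e; have del'0 : 0 < del' by rewrite lt_min del0.
have [U [oU NU muU]] : exists U : set R,
    [/\ open U, N `<=` U & (lebesgue_measure (U `\` N) < del'%:E)%E].
  apply: lebesgue_regularity_outer => //.
  suff: (lebesgue_measure N < +oo)%E by [].
  by rewrite N0 ltry.
have le_mu (A B : set R) : measurable A -> measurable B -> A `<=` B ->
    (lebesgue_measure A <= lebesgue_measure B)%E.
  by move=> mA mB AB; apply: le_measure; rewrite ?inE.
have mU : measurable U by exact: measurable_realfun.open_measurable.
have {}muU : (lebesgue_measure U < del'%:E)%E.
  have : (lebesgue_measure U <= lebesgue_measure (U `\` N) + lebesgue_measure N)%E.
    apply: le_trans (measureU2 lebesgue_measure (measurableD mU mN) mN).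
    apply: le_mu => //; first by apply: measurableU => //; exact: measurableD.
    by move=> x Ux; have [Nx|Nx] := pselect (N x); [right|left].
  by rewrite N0 adde0 => /le_lt_trans; apply.
(* X c' holds when, up to the slope e, the increment of k on [a, c'] is carried
   by finitely many successive intervals whose total length is charged to the
   measure of U within (a, c']. *)
pose X (c' : R) := exists (m : nat) (lo up : nat -> R),
  [/\ forall i, (i < m)%N -> a <= lo i /\ lo i <= up i /\ up i <= c',
      forall i j, (i < j)%N -> (j < m)%N -> up i <= lo j,
      ((\sum_(i < m) (up i - lo i))%:E <= lebesgue_measure (U `&` `]a, c']))%E &
      k c' - k a <= e * (c' - a) + \sum_(i < m) (k (up i) - k (lo i))].
have mI u v : measurable (U `&` `]u, v]) by exact: measurableI.
have mon c1 c2 : c1 <= c2 ->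
    (lebesgue_measure (U `&` `]a, c1]) <= lebesgue_measure (U `&` `]a, c2]))%E.
  move=> c12; apply: le_mu; [exact: mI|exact: mI|].
  move=> x [Ux /=]; rewrite !in_itv /= => /andP[ax xc].
  split=> //=. by rewrite ax (le_trans xc).
have [m [lo [up [Hin Hdis Hlen Hk]]]] : X b.
  apply: (@interval_induction a) => //.
    exists 0%N, (fun=> 0), (fun=> 0); split=> //; first by rewrite big_ord0.
    by rewrite !subrr mulr0 big_ord0 addr0.
  move=> s sab; have [Us|nUs] := pselect (U s).
    have /nbhs_ballP[d /= d0 Hd] := open_nbhs_nbhs (conj oU Us).
    exists d => // c1 c2 c1s c1s' c2s c2s' ac1 c2b [m [lo [up [Hin Hdis Hlen Hk]]]].
    have c12 : c1 <= c2 by exact: le_trans c2s.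
    (* The whole interval [c1, c2] lies in U and joins the family. *)
    exists m.+1, (fun i => if i == m then c1 else lo i),
      (fun i => if i == m then c2 else up i).
    have E g1 g2 (F : R -> R -> R) : \sum_(i < m.+1) F (if val i == m then g1 else up i)
        (if val i == m then g2 else lo i) =
        \sum_(i < m) F (up i) (lo i) + F g1 g2.
      rewrite big_ord_recr /= eqxx; congr (_ + _).
      by apply: eq_bigr => i _; rewrite /= !ltn_eqF.
    split.
    - move=> i; rewrite ltnS leq_eqVlt; case: eqP => //= _ im.
      have [? [? ui]] := Hin i im; split=> //; split=> //; exact: le_trans c12.
    - move=> i j ij; rewrite ltnS leq_eqVlt; case: (j =P m) => [jm _|_ /= jm].
        rewrite ltn_eqF -?jm //; have [|? [? ui]] := Hin i => //.
        by rewrite -jm.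
      by rewrite ltn_eqF; [exact: Hdis|exact: ltn_trans jm].
    - rewrite (E c2 c1 (fun x y => x - y)) EFinD.
      apply: (@le_trans _ _ (lebesgue_measure (U `&` `]a, c1]) +
        lebesgue_measure (`]c1, c2] : set R)))%E.
        apply: leeD => //; rewrite lebesgue_measure_itv /= lte_fin.
        move: c12; rewrite le_eqVlt => /orP[/eqP->|->]; first by rewrite ltxx subrr.
        by rewrite EFinB.
      have addm : (lebesgue_measure (U `&` `]a, c1]) +
          lebesgue_measure (`]c1, c2] : set R) =
          lebesgue_measure ((U `&` `]a, c1]) `|` `]c1, c2]))%E.
        apply/esym; apply: measureU; [exact: mI|exact: measurable_itv|].
        apply/seteqP; split=> // x [[_]] /=; rewrite !in_itv /=.
        by move=> /andP[_ xc1] /andP[c1x _]; move: (lt_le_trans c1x xc1); rewrite ltxx.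
      rewrite addm.
      apply: le_mu; [apply: measurableU; [exact: mI|exact: measurable_itv]|exact: mI|].
      move=> x [[Ux]|] /=; rewrite !in_itv /=.
        by move=> /andP[-> xc1]; split=> //; rewrite (le_trans xc1).
      move=> /andP[c1x xc2]; split; last by rewrite (le_lt_trans ac1).
      by apply: Hd; rewrite /ball /= ltr_norml; apply/andP; split; lra.
    - rewrite (E c2 c1 (fun x y => k x - k y)).
      have : 0 <= e * (c2 - c1) by rewrite mulr_ge0 ?subr_ge0 // ltW.
      lra.
  have [l hl lc] : exists2 l, has_deriv_in D h s l & l <= c.
    by apply: contrapT => nP; apply: nUs; apply: NU; apply: NP => /(_ sab).
  have [d d0 Hd] := has_deriv_in_straddle hl lc e0.
  exists d => // c1 c2 c1s c1s' c2s c2s' ac1 c2b [m [lo [up [Hin Hdis Hlen Hk]]]].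
  have c12 : c1 <= c2 by exact: le_trans c2s.
  exists m, lo, up; split=> //.
  - move=> i im; have [? [? ui]] := Hin i im; split=> //; split=> //.
    exact: le_trans c12.
  - exact: le_trans (mon _ _ c12).
  have := Hd c1 c2 c1s c1s' c2s c2s' (abD _ _) (abD _ _).
  rewrite ac1 c2b (le_trans c12) // (le_trans ac1) // => /(_ isT isT).
  move: Hk; rewrite /k; lra.
have small : \sum_(i < m) (up i - lo i) < del'.
  rewrite -lte_fin; apply: le_lt_trans Hlen _; apply: le_lt_trans muU.
  by apply: le_mu => //; exact: subIsetl.
have := Hdel m (fun i => lo i) (fun i => up i) (fun i => Hin i (ltn_ord i)).
have dis (i j : 'I_m) : i != j -> up i <= lo j \/ up j <= lo i.
  rewrite -(inj_eq val_inj) neq_ltn => /orP[ij|ji]; first by left; exact: Hdis.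
  by right; exact: Hdis.
move=> /(_ dis (lt_le_trans small _)); rewrite ge_min lexx => /(_ isT) Hs.
apply: le_trans Hk _; rewrite lerD2l.
have -> : \sum_(i < m) (k (up i) - k (lo i)) =
   \sum_(i < m) (h (up i) - h (lo i)) - c * \sum_(i < m) (up i - lo i).
  by rewrite mulr_sumr -sumrB; apply: eq_bigr => i _; rewrite /k; ring.
apply: lerD; first by rewrite (le_trans _ (ltW Hs)) // ler_sum // => i _; exact: ler_norm.
rewrite -mulNr (le_trans (ler_norm _)) // normrM normrN ler_wpM2l //.
rewrite ger0_norm; last first.
  by apply: sumr_ge0 => i _; rewrite subr_ge0; have [_ []] := Hin i (ltn_ord i).
by rewrite (le_trans (ltW small)) // ge_min lexx orbT.
Qed.

Lemma ae_imply (A B : R -> Prop) : (forall t, A t -> B t) ->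
  {ae lebesgue_measure, forall t : R, A t} ->
  {ae lebesgue_measure, forall t : R, B t}.
Proof.
by move=> AB [N [mN N0 NP]]; exists N; split => // t /= nB; apply: NP => /AB.
Qed.

(** As rho is continuous, the derivative is within e of rho t almost everywhere
    near t, so the increments of f near t are within e of those of slope rho t. *)
Lemma ae_deriv_in_everywhere k (t0 : R) (f rho : R -> 'cV[R]_k) :
  (forall b, abs_continuous t0 b f) ->
  {ae lebesgue_measure, forall t : R, t0 <= t ->
     has_deriv_in `[t0, +oo[ f t (rho t)} ->
  (forall t, t0 <= t -> forall i,
     rho s i 0 @[s --> within `[t0, +oo[ (nbhs t)] --> rho t i 0) ->
  forall t, t0 <= t -> has_deriv_in `[t0, +oo[ f t (rho t).
Proof.
move=> ac aeD crho t t0t; apply: has_deriv_in_mxP => i j; rewrite ord1 {j}.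
apply/has_deriv_inP => e e0.
have /cvgrPdist_le/(_ e e0) := crho t t0t i.
rewrite near_withinE => /nbhs_ballP[d /= d0 Hd].
have inD s : t0 <= s -> `[t0, +oo[%classic s by move=> ts; rewrite /= in_itv /= ts.
have incr a b : t0 <= a -> a <= b ->
    (forall s, a <= s <= b -> `|t - s| < d) ->
    `|f b i 0 - f a i 0 - (b - a) * rho t i 0| <= e * (b - a).
  move=> ta ab near_t.
  have aci : abs_continuous a b (fun s => f s i 0 : R^o).
    apply: abs_continuous_mxE; exact: (abs_continuous_sub ta (lexx b) (ac b)).
  have abD s : a <= s <= b -> `[t0, +oo[%classic s.
    by case/andP=> as_ _; apply: inD; exact: le_trans as_.
  have near_rho s : a <= s <= b -> `|rho t i 0 - rho s i 0| <= e.
    by move=> sab; apply: Hd; [exact: near_t | exact: abD].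
  have I1 : f b i 0 - f a i 0 <= (rho t i 0 + e) * (b - a).
    apply: (abs_continuous_increment_le ab abD aci).
    move: aeD; apply: ae_imply => s H sab; exists (rho s i 0).
      by apply: has_deriv_in_mxE; apply: H; case/andP: sab => /(le_trans ta).
    by have := near_rho s sab; rewrite ler_norml => /andP[? ?]; lra.
  have I2 : - f b i 0 - - f a i 0 <= (- rho t i 0 + e) * (b - a).
    apply: (abs_continuous_increment_le ab abD (abs_continuousN aci)).
    move: aeD; apply: ae_imply => s H sab; exists (- rho s i 0).
      have Hs : t0 <= s by case/andP: sab => /(le_trans ta).
      have := has_deriv_inM (has_deriv_in_cst `[t0, +oo[ (-1) s)
        (has_deriv_in_mxE (H Hs) (i := i) (j := 0)).
      rewrite mul0r add0r mulN1r; congr has_deriv_in.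
      by apply/funext => z; rewrite mulN1r.
    by have := near_rho s sab; rewrite ler_norml => /andP[? ?]; lra.
  by rewrite ler_norml; apply/andP; split; lra.
exists d => // h hd; rewrite /= in_itv /= andbT => th.
have [h0|h0] := leP 0 h.
  have := incr t (t + h) t0t; rewrite lerDl (_ : t + h - t = h); last by ring.
  move=> /(_ h0).
  rewrite (ger0_norm h0); apply => s /andP[ts sth].
  rewrite distrC ger0_norm ?subr_ge0 //; move: hd; rewrite ger0_norm //; lra.
have := incr (t + h) t th; rewrite gerDl (_ : t - (t + h) = - h); last by ring.
move=> /(_ (ltW h0)); rewrite (ler0_norm (ltW h0)) => H.
rewrite -normrN; apply: le_trans (H _).
  by rewrite le_eqVlt; apply/orP; left; apply/eqP; congr (`|_|); rewrite /GRing.scale /=; ring.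
move=> s /andP[ts sth].
rewrite ger0_norm ?subr_ge0 //; move: hd; rewrite ltr0_norm //; lra.
Qed.

End AbsolutelyContinuous.

(** * The functional along trajectories *)

Section ContinuousEntries.
Context {R : realType}.

Definition ccont k (x : R -> 'cV[R]_k) := forall i, continuous (fun t => x t i 0).

Lemma continuous_sum k (g : 'I_k -> R -> R) :
  (forall i, continuous (g i)) -> continuous (fun t => \sum_i g i t).
Proof.
elim: k g => [|k IH] g H.
  under eq_fun do rewrite big_ord0.
  by move=> t; exact: cvg_cst.
under eq_fun do rewrite big_ord_recl.
by move=> t; apply: cvgD; [exact: H|apply: (IH (fun i => g (lift ord0 i)))].
Qed.

Lemma ccont_dot_mulmx k (A : 'M[R]_k) (x : R -> 'cV[R]_k) : ccont x ->
  continuous (fun t => dot (x t) (A *m x t)).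
Proof.
move=> cx; under eq_fun do rewrite dotE.
apply: continuous_sum => i t; apply: cvgM; first exact: cx.
have: continuous (fun t => (A *m x t) i 0); last exact.
under eq_fun do rewrite mxE.
by apply: continuous_sum => j s; apply: cvgM; [exact: cvg_cst|exact: cx].
Qed.

Lemma continuous_shift (g : R -> R) s : continuous g -> continuous (fun t => g (s + t)).
Proof.
move=> cg t; apply: (@continuous_comp _ _ _ (fun t => s + t) g); last exact: cg.
by apply: cvgD; [exact: cvg_cst|exact: cvg_id].
Qed.

Lemma ccont_segment k (x : R -> 'cV[R]_k) t r : ccont x -> mcont r (segment x t).
Proof.
move=> cx i j; rewrite ord1; apply: continuous_icont; rewrite /segment.
exact: (@continuous_shift (fun s => x s i 0) t (cx i)).
Qed.

End ContinuousEntries.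

Section AlongTrajectories.
Context {R : realType}.
Variables (n d : nat) (r : R) (f : R -> 'cV[R]_d) (M : 'M[R]_d).
Hypothesis r0 : 0 < r.
Hypothesis df : forall tau : R, tau \in `[- r, 0] ->
  has_deriv_in `[- r, 0] f tau (M *m f tau).

Lemma f_mcont : mcont r f.
Proof.
move=> i j; rewrite ord1.
apply: (@has_deriv_in_continuous _ R^o _ _ (fun t => (M *m f t) i 0)) => t tI.
exact: has_deriv_in_mxE (df tI).
Qed.

Lemma fmoment_deriv (x : R -> 'cV[R]_n) (D : set R) t : ccont x ->
  has_deriv_in D (fun s => fmoment r f (segment x s)) t
    (fI n (f 0) *m x t - fI n (f (- r)) *m x (t - r)
     - (M *t 1%:M) *m fmoment r f (segment x t)).
Proof.
move=> cx; apply: has_deriv_in_mxP => i j; rewrite ord1 {j}.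
pose i1 := (mxtens_unindex i).1; pose i2 := (mxtens_unindex i).2.
have cMf : icont r (fun tau => (M *m f tau) i1 0).
  by apply: (mcont_mulmx (@mcont_cst _ r _ _ M) f_mcont).
have dfi tau : tau \in `[- r, 0] ->
    has_deriv_in `[- r, 0] (fun s => f s i1 0 : R^o) tau ((M *m f tau) i1 0).
  by move=> tI; exact: has_deriv_in_mxE (df tI).
have H := delay_integral_deriv r0 D (t := t) dfi cMf (cx i2).
have -> : (fI n (f 0) *m x t - fI n (f (- r)) *m x (t - r)
     - (M *t 1%:M) *m fmoment r f (segment x t)) i 0 =
  f 0 i1 0 * x t i2 0 - f (- r) i1 0 * x (t - r) i2 0 -
  itg r (fun tau => (M *m f tau) i1 0 * x (t + tau) i2 0).
  have subE (A B : 'cV[R]_(d * n)) : (A - B) i 0 = A i 0 - B i 0 by rewrite !mxE.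
  rewrite !subE !mul_fIE -/i1 -/i2.
  congr (_ - _); rewrite /fmoment mulmx_mint //; last first.
    by apply: mcont_fmul; [exact: f_mcont|exact: ccont_segment].
  rewrite mxE; apply: eq_itg => tau _.
  by rewrite mulmxA tens_mul_fI mulmx1 mul_fIE.
move: H; congr has_deriv_in; apply/funext => s.
by rewrite /fmoment mxE; apply: eq_itg => tau _; rewrite mul_fIE.
Qed.

Variables (P S U : 'M[R]_n) (Q : 'M[R]_(n, d * n)) (Rm : 'M[R]_(d * n)).
Hypotheses (sP : symmetric_mx P) (sR : symmetric_mx Rm).
Hypotheses (sS : symmetric_mx S) (sU : symmetric_mx U).

Let V := krasovskii r f P S U Q Rm.

Lemma itg_weight_split (phi : R -> 'cV[R]_n) : mcont r phi ->
  itg r (fun tau => dot (phi tau) ((S + (tau + r) *: U) *m phi tau)) =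
  itg r (fun tau => dot (phi tau) (S *m phi tau)) +
  itg r (fun tau => (tau + r) * dot (phi tau) (U *m phi tau)).
Proof.
move=> cphi; have cA (A : 'M[R]_n) : icont r (fun tau => dot (phi tau) (A *m phi tau)).
  by apply: icont_dot => //; apply: mcont_mulmx => //; exact: mcont_cst.
rewrite -itgD //.
  by apply: eq_itg => t _; rewrite mulmxDl dotDr -scalemxAl dotZr.
apply: icontM => //; apply: continuous_icont => t.
by apply: cvgD; [exact: cvg_id|exact: cvg_cst].
Qed.

(** The quadratic part contributes through the derivative xi' of the moments. The
    weight S + (tau + r) U takes the values S + r U and S at the ends of the
    delay interval, which gives the boundary terms, and its derivative U gives
    the integral. *)
Lemma krasovskii_deriv (x : R -> 'cV[R]_n) (D : set R) (t : R) (x' : 'cV[R]_n) :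
  ccont x -> has_deriv_in D x t x' ->
  let xi := fmoment r f (segment x t) in
  let xi' := fI n (f 0) *m x t - fI n (f (- r)) *m x (t - r) - (M *t 1%:M) *m xi in
  has_deriv_in D (fun s => V (segment x s) : R^o) t
    (2 * (dot (P *m x t + Q *m xi) x' + dot (Q^T *m x t + Rm *m xi) xi')
     + dot (x t) ((S + r *: U) *m x t) - dot (x (t - r)) (S *m x (t - r))
     - itg r (fun tau => dot (x (t + tau)) (U *m x (t + tau)))).
Proof.
move=> cx dx xi xi'; have dxi : has_deriv_in D _ t xi' := fmoment_deriv D (t := t) cx.
pose H := block_mx P Q Q^T Rm.
have sH : symmetric_mx H by rewrite /symmetric_mx tr_block_mx trmxK sP sR.
pose Y s := col_mx (x s) (fmoment r f (segment x s)).
have dY : has_deriv_in D Y t (col_mx x' xi').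
  apply: has_deriv_in_mxP => i j; rewrite ord1; case: (split_ordP i) => a ->.
    have := has_deriv_in_mxE dx (i := a) (j := 0); rewrite col_mxEu.
    by congr has_deriv_in; apply/funext => s; rewrite col_mxEu.
  have := has_deriv_in_mxE dxi (i := a) (j := 0); rewrite col_mxEd.
  by congr has_deriv_in; apply/funext => s; rewrite col_mxEd.
have dHY : has_deriv_in D (fun s => H *m Y s) t (H *m col_mx x' xi').
  apply: has_deriv_in_mxP => i j; rewrite ord1 mxE.
  have := has_deriv_in_sum (fun a => has_deriv_inM (has_deriv_in_cst D (H i a) t)
     (has_deriv_in_mxE dY (i := a) (j := 0))).
  congr has_deriv_in; last by apply: eq_bigr => a _; rewrite mul0r add0r.
  by apply/funext => s; rewrite mxE.
have dq := has_deriv_in_dot dY dHY.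
have cgA (A : 'M[R]_n) := ccont_dot_mulmx (A := A) cx.
have d1 (tau : R) : tau \in `[- r, 0] ->
    has_deriv_in `[- r, 0] (fun=> 1 : R^o) tau 0.
  by move=> _; exact: has_deriv_in_cst.
have d2 (tau : R) : tau \in `[- r, 0] ->
    has_deriv_in `[- r, 0] (fun s => s + r : R^o) tau 1.
  move=> _; apply/has_deriv_inP => e e0; exists 1 => // h _ _.
  have -> : tau + h + r - (tau + r) - h *: (1 : R^o) = 0.
    by rewrite /GRing.scale /=; ring.
  by rewrite normr0 mulr_ge0 // ltW.
have iS := delay_integral_deriv r0 D (t := t) d1 (@icont_cst _ r 0) (cgA S).
have iU := delay_integral_deriv r0 D (t := t) d2 (@icont_cst _ r 1) (cgA U).
have := has_deriv_inD dq (has_deriv_inD iS iU).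
have -> : (fun s => dot (Y s) (H *m Y s) +
    (itg r (fun tau => 1 * dot (x (s + tau)) (S *m x (s + tau))) +
     itg r (fun tau => (tau + r) * dot (x (s + tau)) (U *m x (s + tau))))) =
  (fun s => V (segment x s)).
  apply/funext => s; rewrite /V /krasovskii /krasovskii_form.
  rewrite itg_weight_split; last exact: ccont_segment.
  have -> : segment x s 0 = x s by rewrite /segment addr0.
  congr (_ + (_ + _)).
  by apply: eq_itg => tau _; rewrite mul1r.
congr has_deriv_in.
have -> : itg r (fun tau => 0 * dot (x (t + tau)) (S *m x (t + tau))) = 0.
  rewrite -[RHS](mul0r r) -itg_cst //.
  by apply: eq_itg => tau _; rewrite mul0r.
have -> : itg r (fun tau => 1 * dot (x (t + tau)) (U *m x (t + tau))) =
    itg r (fun tau => dot (x (t + tau)) (U *m x (t + tau))).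
  by apply: eq_itg => tau _; rewrite mul1r.
rewrite [dot (col_mx x' xi') _](dot_sym _ _ sH) dot_mulmxr sH.
rewrite mul_block_col dot_col_mx mulmxDl [dot (x t) (_ + _)]dotDr -scalemxAl.
rewrite dotZr -/xi; ring.
Qed.

Hypotheses (pS : posdef S) (pU : posdef U).
Let G := mint r (fun tau => f tau *m (f tau)^T).
Hypothesis pG : posdef G.
Hypothesis pPQ : posdef (block_mx P Q Q^T (Rm + invmx G *t S)).

(** By Bessel's inequality the integral of S dominates the form of G^-1 (x) S at
    the moments xi, which completes the quadratic part of V to the form of the
    matrix assumed positive definite; the integral of U is nonnegative. *)
Lemma krasovskii_coercive : exists2 c : R, 0 < c &
  forall phi, hist_space r phi -> 0 <= V phi /\ forall i, (phi 0 i 0) ^+ 2 <= c * V phi.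
Proof.
have [c c0 Hc] := posdef_coord_bound pPQ.
exists c => // phi sphi; have cphi := hist_mcont sphi.
set Y := col_mx (phi 0) (fmoment r f phi).
have lb : dot Y (block_mx P Q Q^T (Rm + invmx G *t S) *m Y) <= V phi.
  have -> : block_mx P Q Q^T (Rm + invmx G *t S) =
      block_mx P Q Q^T Rm + block_mx 0 0 0 (invmx G *t S).
    by rewrite add_block_mx !addr0.
  rewrite mulmxDl dotDr /V /krasovskii /krasovskii_form -/Y lerD2l.
  rewrite mul_block_col !mul0mx !add0r dot_col_mx dot0r add0r.
  rewrite itg_weight_split //.
  apply: le_trans (fmoment_bessel r0 f_mcont pS pG cphi) _.
  rewrite lerDl; apply: itg_ge0 => tau; rewrite in_itv /= => /andP[rt _].
  by rewrite mulr_ge0 ?posdef_ge0 // -lerBlDr sub0r.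
split; first exact: le_trans (posdef_ge0 _ pPQ) lb.
move=> i; apply: (@le_trans _ _ (c * dot Y (block_mx P Q Q^T (Rm + invmx G *t S) *m Y))).
  by have := Hc Y (lshift _ i); rewrite col_mxEu.
by rewrite ler_pM2l.
Qed.

End AlongTrajectories.

(** * Solutions as continuous trajectories *)

Section ClosedLoopAnalysis.
Context {R : realType}.

Lemma ccont_continuous k (y : R -> 'cV[R]_k) : ccont y -> continuous y.
Proof.
move=> cy t; apply/cvgrPdist_le => e e0.
have N (i : 'I_k) : \forall s \near t, `|y t i 0 - y s i 0| <= e.
  by have /cvgrPdist_le/(_ e e0) := cy i t.
move/filter_forall : N; apply: filterS => s Hs.
by apply: mx_norm_le_entries => [|i j]; [exact: ltW | rewrite ord1 !mxE; exact: Hs].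
Qed.

Lemma segment_hist k (y : R -> 'cV[R]_k) r t : ccont y -> hist_space r (segment y t).
Proof.
move=> cy; apply: continuous_subspaceT => s.
apply: (@continuous_comp _ _ _ (fun s => t + s) y); last exact: ccont_continuous.
by apply: cvgD; [exact: cvg_cst|exact: cvg_id].
Qed.

Lemma abs_continuous_cvg k (a b : R) (x : R -> 'cV[R]_k) t :
  abs_continuous a b x -> a <= t < b ->
  x s @[s --> within `[a, +oo[ (nbhs t)] --> x t.
Proof.
move=> ac /andP[at_ tb]; apply/cvgrPdist_le => e e0.
have [del del0 H] := ac e e0.
rewrite near_withinE; apply/nbhs_ballP.
exists (Num.min del (b - t)); first by rewrite /= lt_min del0 subr_gt0.
move=> s; rewrite /ball /= lt_min in_itv /= andbT => /andP[sd sb] as_.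
have one (u v : R) : a <= u -> u <= v -> v <= b -> v - u < del -> `|x v - x u| < e.
  move=> au uv vb vud.
  have := H 1%N (fun=> u) (fun=> v) (fun _ => conj au (conj uv vb)).
  rewrite !big_ord1; apply => // i j; by rewrite !ord1.
have [st|ts] := leP s t.
  by apply/ltW/one => //; [exact: ltW | rewrite -(ger0_norm (x := t - s)) ?subr_ge0].
rewrite distrC; apply/ltW/one => //; first exact: ltW.
  by move: sb; rewrite distrC gtr0_norm ?subr_gt0 // ltrD2r => /ltW.
by move: sd; rewrite distrC gtr0_norm // subr_gt0.
Qed.

(** Freezing a solution to the left of the initial interval turns it into a
    continuous function on the whole line; the segments x_t with t >= t0 do not
    change. *)
Lemma solution_extension k (r t0 : R) (phi x : R -> 'cV[R]_k) : 0 < r ->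
  hist_space r phi -> (forall theta, theta \in `[- r, 0] -> x (t0 + theta) = phi theta) ->
  (forall b, abs_continuous t0 b x) ->
  exists2 y, ccont y & forall t, t0 - r <= t -> y t = x t.
Proof.
move=> r0 sphi xphi ac.
have cx1 : {within `[t0 - r, t0], continuous x}.
  have E : {in `[t0 - r, t0]%classic, (fun s => phi (s - t0)) =1 x}.
    move=> s; rewrite inE /= in_itv /= => /andP[s1 s2].
    rewrite -xphi; first by rewrite addrC subrK.
    by rewrite in_itv /=; apply/andP; split; lra.
  apply: (subspace_eq_continuous E).
  apply/subspace_continuousP => s; rewrite /= in_itv /= => /andP[s1 s2].
  have sI : (s - t0) \in `[- r, 0] by rewrite in_itv /=; apply/andP; split; lra.
  have /subspace_continuousP/(_ _ sI)/cvgrPdist_le H := sphi.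
  apply/cvgrPdist_le => e /H; rewrite !near_withinE => /nbhs_ballP[d /= d0 Hd].
  apply/nbhs_ballP; exists d => //= z; rewrite /ball /= in_itv /= => zs /andP[z1 z2].
  apply: Hd.
    have E' : s - t0 - (z - t0) = s - z by ring.
    by rewrite /ball /= E'.
  rewrite /= in_itv /=; apply/andP; split; lra.
have cx2 : {within `[t0, +oo[, continuous x}.
  apply/subspace_continuousP => s; rewrite /= in_itv /= andbT => ts.
  by apply: (abs_continuous_cvg (ac (s + 1))); rewrite ts ltrDl ltr01.
have cx : {within `[t0 - r, t0] `|` `[t0, +oo[, continuous x}.
  by apply: withinU_continuous => //; [exact: itv_closed | exact: rray_closed].
pose c := t0 - r; pose y s := x (Num.max s c).
have cA s : c <= s -> (`[t0 - r, t0] `|` `[t0, +oo[)%classic s.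
  by move=> cs; have [st|ts] := leP s t0; [left|right];
    rewrite /= in_itv /= ?st ?andbT //; exact: ltW.
exists y => [i t|t ct]; last by rewrite /y max_l.
suff cy : y s @[s --> nbhs t] --> y t.
  apply: (@continuous_comp _ _ _ y (fun A : 'cV[R]_k => A i 0) t) => //.
  exact: coord_continuous.
have cm : c <= Num.max t c by rewrite le_max lexx orbT.
have /subspace_continuousP/(_ _ (cA _ cm))/cvgrPdist_le H := cx.
apply/cvgrPdist_le => e /H; rewrite near_withinE => /nbhs_ballP[del /= del0 Hd].
apply/nbhs_ballP; exists del => //= s; rewrite /ball /= => sdel.
apply: Hd; last by apply: cA; rewrite le_max lexx orbT.
apply: le_lt_trans sdel; rewrite /ball /=.
by case: (leP t c); case: (leP s c) => ? ?; rewrite ?subrr ?normr0 //;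
  rewrite ler_norml; apply/andP; split; have := ler_norm (t - s);
  have := ler_norm (s - t); rewrite distrC; lra.
Qed.

Lemma hist_norm_le n (r : R) (phi : R -> 'cV[R]_n) (c : R) : 0 < r ->
  (forall theta, theta \in `[- r, 0] -> `|phi theta| <= c) -> hist_norm r phi <= c.
Proof.
move=> r0 H; apply: ge_sup; last by move=> _ [s sI <-]; exact: H.
by exists `|phi 0|; exists 0 => //=; exact: mem0_itv.
Qed.

End ClosedLoopAnalysis.

Section Trajectories.
Context {R : realType}.
Variables (n d q : nat) (r t0 : R) (f : R -> 'cV[R]_d) (M : 'M[R]_d).
Variable Acl : 'M[R]_(n, n + (n + d * n) + q).
Hypothesis r0 : 0 < r.
Hypothesis df : forall tau : R, tau \in `[- r, 0] ->
  has_deriv_in `[- r, 0] f tau (M *m f tau).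

Lemma eq_chi (x y : R -> 'cV[R]_n) (w : R -> 'cV[R]_q) t :
  (forall s, t - r <= s -> x s = y s) -> chi r f x w t = chi r f y w t.
Proof.
move=> xy; have xt : x t = y t by apply: xy; rewrite gerBl ltW.
have xtr : x (t - r) = y (t - r) by exact: xy.
have xI : fmoment r f (segment x t) = fmoment r f (segment y t).
  apply: eq_mint => th; rewrite in_itv /= => /andP[rt _].
  by rewrite /segment xy // lerD2l.
by rewrite /chi xt xtr -/(segment x t) -/(segment y t) -/(fmoment r f _) xI.
Qed.

Lemma ccont_chi (y : R -> 'cV[R]_n) : ccont y -> ccont (chi r f y (fun=> (0 : 'cV[R]_q))).
Proof.
move=> cy j.
case: (split_ordP j) => a ->; last first.
  rewrite (_ : (fun _ => _) = fun=> (0 : 'cV[R]_q) a 0); first by move=> t; exact: cvg_cst.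
  by apply/funext => s; rewrite col_mxEd.
case: (split_ordP a) => b ->.
  rewrite (_ : (fun _ => _) = fun s => y s b 0); first exact: cy.
  by apply/funext => s; rewrite !col_mxEu.
case: (split_ordP b) => e ->.
  rewrite (_ : (fun _ => _) = fun s => y (s - r) e 0).
    move=> t; apply: (@continuous_comp _ _ _ (fun t => t - r) (fun s => y s e 0)).
      by apply: cvgD; [exact: cvg_id|exact: cvg_cst].
    exact: cy.
  by apply/funext => s; rewrite col_mxEu col_mxEd col_mxEu.
rewrite (_ : (fun _ => _) = fun s => fmoment r f (segment y s) e 0) => [t|].
  have := has_deriv_in_mxE (fmoment_deriv r0 df setT (t := t) cy) (i := e) (j := 0).
  move=> /has_deriv_in_cvg/cvgrPdist_le H; apply/cvgrPdist_le => e0 /H.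
  by rewrite near_withinE; apply: filterS => s; exact.
by apply/funext => s; rewrite col_mxEu !col_mxEd.
Qed.

Definition zero_input_trajectory (phi y : R -> 'cV[R]_n) : Prop :=
  [/\ ccont y, forall theta, theta \in `[- r, 0] -> y (t0 + theta) = phi theta &
      forall t, t0 <= t -> has_deriv_in `[t0, +oo[ y t (Acl *m chi r f y (fun=> 0) t)].

(** Without input the right-hand side is continuous along a solution, so that
    Caratheodory solutions are classical. *)
Lemma zero_input_solution (phi x : R -> 'cV[R]_n) : hist_space r phi ->
  cls_solution r f Acl t0 phi (fun=> 0) x ->
  exists2 y, zero_input_trajectory phi y & forall t, t0 - r <= t -> y t = x t.
Proof.
move=> sphi [xphi ac st]; have [y cy yx] := solution_extension r0 sphi xphi ac.
have yx0 t : t0 <= t -> y t = x t.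
  by move=> t0t; rewrite yx // lerBlDr (le_trans t0t) // lerDl ltW.
exists y => //; split=> // [theta thI|].
  rewrite -xphi // yx //; move: thI; rewrite in_itv /= => /andP[rt _].
  by rewrite lerD2l.
apply: ae_deriv_in_everywhere => [b||t t0t i].
- move=> e e0; have [del del0 H] := ac b e e0; exists del => // k lo up lu dis small.
  apply: le_lt_trans (H k lo up lu dis small); apply: ler_sum => j _.
  by have [lj [uj _]] := lu j; rewrite !yx0 // (le_trans lj).
- apply: ae_imply st => t H t0t; rewrite (@eq_chi y x) => [|s ts].
    apply: eq_has_deriv_in (H t0t) => [s|]; rewrite /= in_itv /= andbT // => ts.
    by rewrite yx0.
  by rewrite yx // (le_trans _ ts) // lerD2r.
apply: cvg_within_filter.
have: continuous (fun s => (Acl *m chi r f y (fun=> 0) s) i 0); last exact.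
under eq_fun do rewrite mxE.
apply: continuous_sum => j s; apply: cvgM; first exact: cvg_cst.
exact: ccont_chi.
Qed.

End Trajectories.

(** * Strict dissipation *)

Section SupplyRate.
Context {R : realType}.

Lemma supply_rate_zero_input m q (J1 Jt : 'M[R]_m) (J2 : 'M[R]_(m, q))
  (J3 : 'M[R]_q) (z : 'cV[R]_m) :
  negdef (invmx J1) -> supply_rate J1 Jt J2 J3 z 0 <= 0.
Proof.
move=> nJ1; rewrite /supply_rate quadE mul_block_col dot_col_mx dot0l addr0.
rewrite mulmx0 addr0 -!mulmxA dot_mulmxr trmxK.
by have := posdef_ge0 (Jt *m z) nJ1; rewrite mulNmx dotNr oppr_ge0.
Qed.

End SupplyRate.

Section StrictDissipation.
Context {R : realType}.
Variables (n m d q : nat) (r : R) (f : R -> 'cV[R]_d).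
Variables (Acl : 'M[R]_(n, n + (n + d * n) + q))
          (Sigma : 'M[R]_(m, n + (n + d * n) + q)).

(** The margin c y_i^2 is what attractivity will need. The derivative is taken
    relative to any set D so as to include one-sided derivatives at t0. *)
Definition strictly_dissipative (v : (R -> 'cV[R]_n) -> R)
    (s : 'cV[R]_m -> 'cV[R]_q -> R) : Prop :=
  exists2 c : R, 0 < c &
  forall (y : R -> 'cV[R]_n) (w : R -> 'cV[R]_q) (D : set R) (t : R), ccont y ->
    has_deriv_in D y t (Acl *m chi r f y w t) ->
    exists2 dv : R, has_deriv_in D (fun t' => v (segment y t') : R^o) t dv &
      let sup := s (Sigma *m chi r f y w t) (w t) in
      dv - sup <= 0 /\ forall i, dv - sup <= - (c * (y t i 0) ^+ 2).

Variables (M : 'M[R]_d).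
Variables (J1 Jt : 'M[R]_m) (J2 : 'M[R]_(m, q)) (J3 : 'M[R]_q).
Variables (P S U : 'M[R]_n) (Q : 'M[R]_(n, d * n)) (Rm : 'M[R]_(d * n)).
Hypothesis r0 : 0 < r.
Hypothesis df : forall tau : R, tau \in `[- r, 0] ->
  has_deriv_in `[- r, 0] f tau (M *m f tau).
Let G := mint r (fun tau => f tau *m (f tau)^T).
Hypothesis pG : posdef G.
Hypothesis uJ1 : J1 \in unitmx.
Hypotheses (sP : symmetric_mx P) (sR : symmetric_mx Rm).
Hypothesis pU : posdef U.
Let PP : 'M[R]_(n, n + (n + d * n) + q + m) :=
  row_mx (row4 P (0 : 'M[R]_n) Q (0 : 'M[R]_(n, q))) 0.
Let Pi : 'M[R]_(n, n + (n + d * n) + q + m) := row_mx Acl 0.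
Let F : 'M[R]_(d * n, n + (n + d * n) + q) :=
  row4 (fI n (f 0)) (- fI n (f (- r))) (- (M *t (1%:M : 'M[R]_n)))
       (0 : 'M[R]_(d * n, q)).
Let Phi : 'M[R]_(n + (n + d * n) + q + m) :=
  Sy (col_mx (col_mx (col_mx Q (col_mx (0 : 'M[R]_(n, d * n)) Rm))
                     (0 : 'M[R]_(q, d * n))) (0 : 'M[R]_(m, d * n))
      *m row_mx F (0 : 'M[R]_(d * n, m)))
  + Sy (col_mx (col_mx (0 : 'M[R]_(n + (n + d * n), m)) (- J2^T)) Jt
      *m row_mx Sigma (0 : 'M[R]_m))
  + dsum (dsum (dsum (S + r *: U) (dsum (- S) (- (invmx G *t U)))) (- J3)) J1.
Hypothesis nLMI : negdef (Phi + Sy (PP^T *m Pi)).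

Let V := krasovskii r f P S U Q Rm.
Let supply := supply_rate J1 Jt J2 J3.
Let cf : mcont r f := f_mcont df.

(** The strict LMI leaves a margin proportional to every squared coordinate of
    the state; the integral term of U is absorbed by Bessel's inequality. *)
Lemma krasovskii_strictly_dissipative : strictly_dissipative V supply.
Proof.
have [c c0 Hc] := posdef_coord_bound nLMI.
exists c^-1 => [|y w D t cy dy]; first by rewrite invr_gt0.
have dV := krasovskii_deriv (S := S) (U := U) (Q := Q) r0 df sP sR cy dy.
eexists; first exact: dV.
move=> s; set xi := fmoment r f (segment y t).
have chiE : chi r f y w t = col_mx (col_mx (y t) (col_mx (y (t - r)) xi)) (w t).
  by [].
have FE : F *m chi r f y w t =
    fI n (f 0) *m y t - fI n (f (- r)) *m y (t - r) - (M *t 1%:M) *m xi.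
  by rewrite chiE /F /row4 !mul_row_col mul0mx addr0 !mulNmx addrA.
set eta := col_mx (chi r f y w t) (- (invmx J1 *m Jt *m (Sigma *m chi r f y w t))).
have E := LMI_quadratic_form r Acl Sigma F P S U Q (invmx G) Jt J2 J3
  (y t) (y (t - r)) xi (w t) sR uJ1.
rewrite /= -chiE -/eta FE in E.
have bU := fmoment_bessel r0 cf pU pG (ccont_segment (t := t) (r := r) cy).
have key : forall a, 0 <= a -> a <= - dot eta ((Phi + Sy (PP^T *m Pi)) *m eta) ->
  2 * (dot (P *m y t + Q *m xi) (Acl *m chi r f y w t) +
       dot (Q^T *m y t + Rm *m xi) (fI n (f 0) *m y t - fI n (f (- r)) *m y (t - r)
          - (M *t 1%:M) *m xi)) + dot (y t) ((S + r *: U) *m y t)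
  - dot (y (t - r)) (S *m y (t - r))
  - itg r (fun tau => dot (y (t + tau)) (U *m y (t + tau))) - s <= - a.
  move=> a a0 Ha; move: E bU; rewrite -/xi -/s -/supply /segment -/G.
  rewrite -/PP -/Pi -/Phi /s /supply; lra.
have nn : 0 <= - dot eta ((Phi + Sy (PP^T *m Pi)) *m eta).
  by have := posdef_ge0 eta nLMI; rewrite mulNmx dotNr.
split; first by have := key 0 (lexx 0) nn; rewrite oppr0.
move=> i; apply: key; first by rewrite mulr_ge0 ?sqr_ge0 // invr_ge0 ltW.
rewrite ler_pdivrMl //.
have := Hc eta (lshift _ (lshift _ (lshift _ i))).
by rewrite !col_mxEu mulNmx dotNr.
Qed.

End StrictDissipation.

(** * Dissipativity and asymptotic stability *)

Section ClosedLoopStability.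
Context {R : realType}.
Variables (n m d q : nat) (r t0 : R) (f : R -> 'cV[R]_d) (M : 'M[R]_d).
Variables (Acl : 'M[R]_(n, n + (n + d * n) + q))
          (Sigma : 'M[R]_(m, n + (n + d * n) + q)).
Variable supply : 'cV[R]_m -> 'cV[R]_q -> R.
Variables (P S U : 'M[R]_n) (Q : 'M[R]_(n, d * n)) (Rm : 'M[R]_(d * n)).
Hypothesis r0 : 0 < r.
Hypothesis df : forall tau : R, tau \in `[- r, 0] ->
  has_deriv_in `[- r, 0] f tau (M *m f tau).
Let G := mint r (fun tau => f tau *m (f tau)^T).
Hypothesis pG : posdef G.
Hypotheses (sP : symmetric_mx P) (sR : symmetric_mx Rm).
Hypotheses (pS : posdef S) (pU : posdef U).
Hypothesis pPQ : posdef (block_mx P Q Q^T (Rm + invmx G *t S)).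

Let V := krasovskii r f P S U Q Rm.
Hypothesis sdV : strictly_dissipative r f Acl Sigma V supply.

Let sS : symmetric_mx S. Proof. by case: pS. Qed.
Let sU : symmetric_mx U. Proof. by case: pU. Qed.
Let cf : mcont r f := f_mcont df.
Let V_coercive := krasovskii_coercive r0 df pS pU pG pPQ.
Let V_bilinear := krasovskii_bilinear r0 cf Q sP sR sS sU.

Lemma closed_loop_dissipative : dissipative r f Acl Sigma t0 supply.
Proof.
have [c c0 Hc] := V_coercive; have [c' c'0 Hd] := sdV.
exists V; split.
- by move=> phi psi _ _; exact: eq_krasovskii.
- by move=> phi /Hc[].
- exact: (hist_quadratic_differentiable r0 V_bilinear).
move=> phi w x sphi _ [xphi ac _] t t0t st.
have [y cy yx] := solution_extension r0 sphi xphi ac.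
have Dt : `[t0, +oo[%classic t by rewrite /= in_itv /= andbT.
have chiE : chi r f y w t = chi r f x w t.
  by apply: eq_chi => // s ts; rewrite yx // (le_trans _ ts) // lerD2r.
have dy : has_deriv_in `[t0, +oo[ y t (Acl *m chi r f y w t).
  rewrite chiE; apply: eq_has_deriv_in st => // s; rewrite /= in_itv /= andbT => ts.
  by rewrite yx // lerBlDr (le_trans ts) // lerDl ltW.
have [dv dV [le0 _]] := Hd y w `[t0, +oo[%classic t cy dy.
exists dv; last by rewrite /output -chiE.
apply: eq_has_deriv_in dV => // s; rewrite /= in_itv /= andbT => ts.
apply: eq_krasovskii => // th; rewrite in_itv /= => /andP[rt _].
by rewrite /segment yx // lerD.
Qed.

Hypothesis supply0 : forall z, supply z 0 <= 0.

Lemma krasovskii_decay (phi y : R -> 'cV[R]_n) : zero_input_trajectory r t0 f Acl phi y ->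
  exists2 c : R, 0 < c & forall t, t0 <= t ->
    exists2 dv : R, has_deriv_in `[t0, +oo[ (fun s => V (segment y s) : R^o) t dv &
      dv <= 0 /\ forall i, dv <= - (c * (y t i 0) ^+ 2).
Proof.
move=> [cy _ st]; have [c c0 Hc] := sdV.
exists c => // t t0t; have [dv dV [le0 le]] := Hc y _ _ t cy (st t t0t).
have s0 := supply0 (Sigma *m chi r f y (fun=> 0) t).
exists dv => //; split; first lra.
by move=> i; have := le i; lra.
Qed.

(** Along y the functional does not increase; it dominates a multiple of every
    y_i^2, and initially it is at most a multiple of the squared norm of phi. *)
Lemma zero_input_bound : exists2 k : R, 0 < k & forall phi y, hist_space r phi ->
  zero_input_trajectory r t0 f Acl phi y ->
  forall t, t0 <= t -> `|y t| <= k * hist_norm r phi.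
Proof.
have [_ _ [b b0 Hb]] := V_bilinear.
have [c c0 Hc] := V_coercive.
have k0 : 0 < 1 + c * b by rewrite ltr_pwDl // mulr_ge0 // ltW.
exists (1 + c * b) => // phi y sphi ytraj t t0t; have [cy yphi st] := ytraj.
have [c' _ dV] := krasovskii_decay ytraj.
have h0 := hist_norm_ge0 r0 sphi.
have Vt : V (segment y t) <= b * hist_norm r phi ^+ 2.
  apply: (@le_trans _ _ (V (segment y t0))).
    rewrite -subr_le0 -(mul0r (t - t0)).
    apply: (@deriv_in_increment_le _ `[t0, +oo[%classic
      (fun s => V (segment y s))) => // s /andP[s0 _].
      by rewrite /= in_itv /= andbT.
    by have [dv hdv [dv0 _]] := dV s s0; exists dv.
  rewrite /V (@eq_krasovskii _ _ _ _ _ r0 _ _ _ _ _ (segment y t0) phi) //.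
  by apply: le_trans (ler_norm _) _; apply: le_trans (Hb _ _ sphi sphi) _; rewrite expr2.
apply: mx_norm_le_entries => [|i j]; first by rewrite mulr_ge0 // ltW.
rewrite ord1 {j}; have [_ /(_ i)] := Hc _ (segment_hist (t := t) (r := r) cy).
rewrite {1}/segment addr0 => Hi.
have H2 : (y t i 0) ^+ 2 <= ((1 + c * b) * hist_norm r phi) ^+ 2.
  apply: le_trans Hi _; apply: (@le_trans _ _ (c * (b * hist_norm r phi ^+ 2))).
    by rewrite ler_pM2l.
  rewrite exprMn mulrA ler_wpM2r ?sqr_ge0 //.
  have : 0 <= c * b by rewrite mulr_ge0 // ltW.
  by set a := c * b; nra.
have k1 : 0 <= (1 + c * b) * hist_norm r phi by rewrite mulr_ge0 // ltW.
by rewrite -ler_sqr ?nnegrE // real_normK ?num_real.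
Qed.

(** Barbalat's argument. The derivative of y is bounded, so an excursion of
    y_i above e lasts a fixed time and costs V a fixed amount; V being bounded
    below, no excursion starts once V is close enough to its infimum. *)
Lemma zero_input_attractive (phi y : R -> 'cV[R]_n) :
  hist_space r phi -> zero_input_trajectory r t0 f Acl phi y -> forall e : R, 0 < e ->
  exists2 T : R, t0 <= T & forall t, T <= t -> `|y t| <= e.
Proof.
move=> sphi ytraj e e0; have [cy yphi st] := ytraj.
have [c c0 dV] := krasovskii_decay ytraj.
have [k k0 Hk] := zero_input_bound.
have [c1 c10 Hc1] := V_coercive.
have [cm cm0 Hcm] := fmoment_norm_le n r0 cf.
have h0 := hist_norm_ge0 r0 sphi.
pose B := (k + 1) * hist_norm r phi.
have yB t : t0 - r <= t -> `|y t| <= B.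
  move=> rt; have [t0t|tt0] := leP t0 t.
    by rewrite (le_trans (Hk _ _ sphi ytraj t t0t)) // /B; nra.
  have tI : t - t0 \in `[- r, 0] by rewrite in_itv /=; apply/andP; split; lra.
  have -> : y t = phi (t - t0) by rewrite -yphi // addrC subrK.
  by rewrite (le_trans (hist_norm_ub r0 sphi tI)) // /B; move: k0 h0; nra.
have B0 : 0 <= B by rewrite mulr_ge0 // addr_ge0 // ltW.
(* L bounds the right-hand side of the equation; 1 makes it positive. *)
pose L := 1 + (n + (n + d * n) + q)%:R * (`|Acl| * (B + (B + cm * B) + 0)).
have L0 : 0 < L by rewrite ltr_pwDl // !mulr_ge0 // !addr_ge0 // mulr_ge0.
have chiL t : t0 <= t -> `|Acl *m chi r f y (fun=> 0) t| <= L.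
  move=> t0t; rewrite (le_trans (mx_norm_mulmx _ _)) // /L ler_wpDl //.
  rewrite ler_wpM2l // ler_wpM2l // (le_trans (mx_norm_col_mx _ _)) //.
  rewrite lerD ?normr0 // (le_trans (mx_norm_col_mx _ _)) //.
  rewrite lerD //; first by apply: yB; move: r0; lra.
  rewrite (le_trans (mx_norm_col_mx _ _)) // lerD //; first by apply: yB; lra.
  apply: le_trans (Hcm _ (segment_hist (t := t) (r := r) cy)) _.
  rewrite ler_wpM2l //; apply: hist_norm_le => // th.
  by rewrite in_itv /= => /andP[rth _]; apply: yB; lra.
have inD s : t0 <= s -> `[t0, +oo[%classic s by rewrite /= in_itv /= andbT.
have lip i s t : t0 <= s -> s <= t -> `|y t i 0 - y s i 0| <= L * (t - s).
  move=> t0s s_t.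
  have sub u : s <= u <= t -> `[t0, +oo[%classic u.
    by case/andP=> su _; apply: inD; exact: le_trans su.
  have bnd u : s <= u <= t -> `|(Acl *m chi r f y (fun=> 0) u) i 0| <= L.
    case/andP=> su _; apply: le_trans (entry_le_mx_norm _ _ _) _.
    by apply: chiL; exact: le_trans su.
  have du u : s <= u <= t -> has_deriv_in `[t0, +oo[ (fun s => y s i 0 : R^o) u
      ((Acl *m chi r f y (fun=> 0) u) i 0).
    by case/andP=> su _; apply: has_deriv_in_mxE; apply: st; exact: le_trans su.
  have I1 : y t i 0 - y s i 0 <= L * (t - s).
    apply: (@deriv_in_increment_le _ `[t0, +oo[%classic (fun s => y s i 0)) => // u uI.
    by exists ((Acl *m chi r f y (fun=> 0) u) i 0); [exact: du|
      exact: le_trans (ler_norm _) (bnd u uI)].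
  have I2 : - y t i 0 - - y s i 0 <= L * (t - s).
    apply: (@deriv_in_increment_le _ `[t0, +oo[%classic (fun s => - y s i 0)) => // u uI.
    exists (- (Acl *m chi r f y (fun=> 0) u) i 0).
      have := has_deriv_inM (has_deriv_in_cst `[t0, +oo[%classic (-1) u) (du u uI).
      rewrite mul0r add0r mulN1r; congr has_deriv_in.
      by apply/funext => z; rewrite mulN1r.
    by rewrite (le_trans (ler_norm _)) // normrN; exact: bnd.
  by rewrite ler_norml; apply/andP; split; lra.
pose W t := V (segment y t).
have W0 t : 0 <= W t by have [] := Hc1 _ (segment_hist (t := t) (r := r) cy).
have Wdec s t : t0 <= s -> s <= t -> W t <= W s.
  move=> t0s s_t; rewrite -subr_le0 -(mul0r (t - s)).
  apply: (@deriv_in_increment_le _ `[t0, +oo[%classic W) => // u /andP[su _].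
    by apply: inD; exact: le_trans su.
  by have [dv hdv [dv0 _]] := dV u (le_trans t0s su); exists dv.
(* If y_i exceeds e at t then it exceeds e / 2 during a time del, in which W
   decreases by at least eta. *)
pose w := inf [set W t | t in `[t0, +oo[].
have has_w : has_inf [set W t | t in `[t0, +oo[].
  split; first by exists (W t0); exists t0; rewrite /= ?in_itv /= ?lexx.
  by exists 0 => _ [t _ <-].
pose del := e / (2 * L); have del0 : 0 < del by rewrite divr_gt0 // mulr_gt0.
pose eta := c * (e / 2) ^+ 2 * del.
have eta0 : 0 < eta.
  by rewrite mulr_gt0 // mulr_gt0 // exprn_gt0 // divr_gt0.
have [_ [T Tt0 <-] WT] := inf_adherent eta0 has_w.
have {}Tt0 : t0 <= T by move: Tt0; rewrite /= in_itv /= andbT.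
exists T => // t Tt; have t0t : t0 <= t by exact: le_trans Tt.
apply: mx_norm_le_entries => [|i j]; first exact: ltW.
rewrite ord1 {j} leNgt; apply/negP => ey.
have t_del : t <= t + del by rewrite lerDl ltW.
have drop : W (t + del) - W t <= - (c * (e / 2) ^+ 2) * (t + del - t).
  apply: (@deriv_in_increment_le _ `[t0, +oo[%classic W) => // u /andP[tu ud].
    by apply: inD; exact: le_trans tu.
  have t0u : t0 <= u by exact: le_trans tu.
  have [dv hdv [_ /(_ i) dvi]] := dV u t0u; exists dv => //.
  apply: le_trans dvi _; rewrite lerN2 ler_pM2l //.
  rewrite -[(y u i 0) ^+ 2]real_normK ?num_real // ler_sqr ?nnegrE ?divr_ge0 ?(ltW e0) //.
  have Lu : L * (u - t) <= e / 2.
    have -> : e / 2 = L * del by rewrite /del; field; rewrite gt_eqF.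
    by rewrite ler_pM2l // lerBlDl.
  have := lip i t u t0t tu; have := ler_normB (y u i 0) (y u i 0 - y t i 0).
  rewrite opprB addrC subrK => H1 H2; move: ey H1 H2 Lu; lra.
have wle : w <= W (t + del).
  apply: ge_inf; first by case: has_w.
  by exists (t + del) => //; apply: inD; exact: le_trans t_del.
have := Wdec T t Tt0 Tt; move: drop; rewrite (_ : t + del - t = del); last by ring.
rewrite mulNr -/eta => drop WtT.
by move: WT wle; rewrite -/w => WT wle; lra.
Qed.

Lemma closed_loop_stable : globally_asymptotically_stable r f Acl t0.
Proof.
split=> [e e0|phi x sphi sol].
  have [k k0 Hk] := zero_input_bound.
  exists (e / k) => [|phi x sphi small sol t t0t]; first exact: divr_gt0.
  have [y ytraj yx] := zero_input_solution r0 df sphi sol.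
  rewrite -yx; last by move: r0 t0t; lra.
  apply: le_lt_trans (Hk _ _ sphi ytraj t t0t) _.
  by rewrite mulrC -ltr_pdivlMr.
have [y ytraj yx] := zero_input_solution r0 df sphi sol.
apply/cvgrPdist_le => e e0.
have [T t0T HT] := zero_input_attractive sphi ytraj e0.
exists T; split; first exact: num_real.
move=> t Tt; rewrite sub0r normrN -yx; first by apply: HT; exact: ltW.
by move: r0 t0T Tt; lra.
Qed.

End ClosedLoopStability.

Theorem theorem2p1 (R : realType) (n p m q d : nat) (r t0 : R)
  (f : R -> 'cV[R]_d) (M : 'M[R]_d)
  (A1 A2 : 'M[R]_n) (A3 : 'M[R]_(n, d * n))
  (B1 B2 : 'M[R]_(n, p)) (B3 : 'M[R]_(n, d * p)) (D1 : 'M[R]_(n, q))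
  (C1 C2 : 'M[R]_(m, n)) (C3 : 'M[R]_(m, d * n))
  (B4 B5 : 'M[R]_(m, p)) (B6 : 'M[R]_(m, d * p)) (D2 : 'M[R]_(m, q))
  (J1 Jt : 'M[R]_m) (J2 : 'M[R]_(m, q)) (J3 : 'M[R]_q) :
  0 < r ->
  C1_on r f ->
  (forall tau : R, tau \in `[- r, 0] ->
     has_deriv_in `[- r, 0] f tau (M *m f tau)) ->
  posdef (mint r (fun tau => f tau *m (f tau)^T)) ->
  symmetric_mx J1 -> J1 \in unitmx -> negdef (invmx J1) -> symmetric_mx J3 ->
  let FF : 'M[R]_d := invmx (mint r (fun tau => f tau *m (f tau)^T)) in
  let A := row4 A1 A2 A3 D1 in
  let BB1 := row4 B1 B2 B3 (0 : 'M[R]_(n, q)) in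
  let C := row4 C1 C2 C3 D2 in
  let BB2 := row4 B4 B5 B6 (0 : 'M[R]_(m, q)) in
  forall K : 'M[R]_(p, n),
  let Acl := A + BB1 *m gain d q K in
  let Sigma := C + BB2 *m gain d q K in
  (exists (P : 'M[R]_n) (Q : 'M[R]_(n, d * n)) (Rm : 'M[R]_(d * n))
          (S U : 'M[R]_n),
     let PP : 'M[R]_(n, n + (n + d * n) + q + m) :=
       row_mx (row4 P (0 : 'M[R]_n) Q (0 : 'M[R]_(n, q))) 0 in
     let Pi : 'M[R]_(n, n + (n + d * n) + q + m) := row_mx Acl 0 in
     let F : 'M[R]_(d * n, n + (n + d * n) + q) :=
       row4 (fI n (f 0)) (- fI n (f (- r))) (- (M *t (1%:M : 'M[R]_n)))
            (0 : 'M[R]_(d * n, q)) in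
     let Phi : 'M[R]_(n + (n + d * n) + q + m) :=
       Sy (col_mx (col_mx (col_mx Q (col_mx (0 : 'M[R]_(n, d * n)) Rm))
                          (0 : 'M[R]_(q, d * n))) (0 : 'M[R]_(m, d * n))
           *m row_mx F (0 : 'M[R]_(d * n, m)))
       + Sy (col_mx (col_mx (0 : 'M[R]_(n + (n + d * n), m)) (- J2^T)) Jt
           *m row_mx Sigma (0 : 'M[R]_m))
       + dsum (dsum (dsum (S + r *: U) (dsum (- S) (- (FF *t U)))) (- J3)) J1 in
     [/\ symmetric_mx P, symmetric_mx Rm, symmetric_mx S & symmetric_mx U] /\
     [/\ posdef (block_mx P Q Q^T (Rm + FF *t S)), posdef S, posdef U &
         negdef (Phi + Sy (PP^T *m Pi))]) ->
  dissipative r f Acl Sigma t0 (supply_rate J1 Jt J2 J3) /\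
  globally_asymptotically_stable r f Acl t0.
Proof.
move=> r0 _ df pG _ uJ1 nJ1 _ FF A BB1 C BB2 K Acl Sigma.
case=> [P [Q [Rm [S [U [[sP sR sS sU] [pPQ pS pU nLMI]]]]]]].
have sdV := krasovskii_strictly_dissipative r0 df pG uJ1 sP sR pU nLMI.
split.
  exact: (closed_loop_dissipative t0 r0 df pG sP sR pS pU pPQ sdV).
apply: (closed_loop_stable t0 r0 df pG sP sR pS pU pPQ sdV) => z.
exact: supply_rate_zero_input.
Qed.
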